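(* Let $\mathcal F=\{f_i(x)=r_ix+b_i\}_{i=1}^m$ be a non-degenerate affine reverse iterated function system on $\mathbb R$, with $r_i,b_i\in\mathbb R$ and $|r_i|>1$ for all $i$. Let $a\in\mathbb R$, and let $s$ be the unique solution of $\sum_{i=1}^m|r_i|^{-s}=1$. Write $\mathcal O=\mathcal O^+_{\mathcal F}(a)$ and suppose that $\mathcal O$ is non-overlapping and uniformly locally finite. Then the following hold. (i) Suppose that $\frac{\log|r_i|}{\log|r_j|}\notin\mathbb Q$ for some $i\ne j$. Then the upper and lower $s$-central densities of $\mathcal O$ coincide, and their common value is $$\begin{aligned}\mathcal C_s(\mathcal O)=\frac{1}{s\sum_{i=1}^m|r_i|^{-s}\log|r_i|}\Biggl[&\sum_{x\in\mathcal O\cap(-1,1)}\Bigl(\sum_{i=1}^m\min\{1,|r_ix|^{-s}\}-1\Bigr)\\&+\sum_{x\in\mathcal O}\sum_{i=1}^m\Bigl(\min\{1,|r_ix+b_i|^{-s}\}-\min\{1,|r_ix|^{-s}\}\Bigr)\\&+\sum_{x\in\mathcal O\setminus\bigcup_{i=1}^mf_i(\mathcal O)}\min\{1,|x|^{-s}\}\Biggr],\end{aligned}$$ with the convention $0^{-s}=\infty$. (ii) Suppose that $\frac{\log|r_i|}{\log|r_j|}\in\mathbb Q$ for all $1\le i,j\le m$; equivalently, there exist $r>1$ and positive integers $k_1,\dots,k_m$ with $\gcd(k_1,\dots,k_m)=1$ and $|r_i|=r^{k_i}$ for $1\le i\le m$. Then there exist a constant $C'>1$ and a function $\phi:[1,\infty)\to(0,\infty)$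 such that $$C'^{-1}\le\phi(h)\le C',\qquad\phi(rh)=\phi(h)\qquad\text{for all }h\ge1,$$ and $$\lim_{h\to\infty}\left|\frac{\#(\mathcal O\cap[-h,h])}{h^s}-\phi(h)\right|=0.$$
   Context: The maps $f_1,\dots,f_m$ are distinct. $\mathcal F$ is degenerate if all the maps $f_i$ have a common fixed point, and non-degenerate otherwise. $G^*(\mathcal F)$ is the semigroup of maps generated by $\mathcal F$ under composition (all nonempty finite compositions), and the forward orbit of $a$ is $\mathcal O^+_{\mathcal F}(a)=\{g(a):g\in G^*(\mathcal F)\}$ (a set, so points are counted once). The orbit $\mathcal O$ is non-overlapping if $f_i(\mathcal O)\cap f_j(\mathcal O)=\varnothing$ whenever $i\ne j$. A set $E\subseteq\mathbb R$ is uniformly locally finite if $\sup_{x\in\mathbb R}\#(E\cap[x-R,x+R])<\infty$ for every $R>0$. For $\alpha>0$, the upper and lower $\alpha$-central densities of a countable set $E\subseteq\mathbb R$ are $\mathcal C_\alpha^+(E)=\limsup_{h\to\infty}\#(E\cap[-h,h])/h^\alpha$ and $\mathcal C_\alpha^-(E)=\liminf_{h\to\infty}\#(E\cap[-h,h])/h^\alpha$; if they agree, the common value is denoted $\mathcal C_\alpha(E)$. *)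

(* Defs.v *)
From mathcomp Require Import all_boot all_order all_algebra.
From mathcomp Require Import all_classical all_reals all_analysis.

Set Implicit Arguments.
Unset Strict Implicit.
Unset Printing Implicit Defensive.

Import Order.TTheory GRing.Theory Num.Theory.
Import numFieldNormedType.Exports.

Local Open Scope classical_set_scope.
Local Open Scope ring_scope.

Definition affine_map (R : realType) (m : nat) (r b : 'I_m -> R) (i : 'I_m) :
  R -> R := fun x => r i * x + b i.

Definition arithmetic_base (R : realType) (m : nat) (r : 'I_m -> R)
    (rho : R) (k : 'I_m -> nat) : Prop :=
  [/\ 1 < rho, forall i, (0 < k i)%N, \big[gcdn/0%N]_(i < m) k i = 1%N &
      forall i, `|r i| = rho ^+ k i].

Section ifs.
Context {R : realType} {m : nat}.
Implicit Types (f : 'I_m -> R -> R) (O : set R).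

Definition degenerate f : Prop := exists x : R, forall i, f i x = x.

(* No identity map is adjoined: only nonempty compositions are generated. *)
Inductive generated_semigroup f : set (R -> R) :=
| generated_map i : generated_semigroup f (f i)
| generated_comp g h : generated_semigroup f g -> generated_semigroup f h ->
    generated_semigroup f (g \o h).

Definition forward_orbit f (a : R) : set R :=
  [set g a | g in generated_semigroup f].

Definition non_overlapping f O : Prop :=
  forall i j, i != j -> f i @` O `&` f j @` O = set0.

End ifs.

Section counting.
Context {R : realType}.
Implicit Types (E : set R) (h alpha : R).
Local Open Scope ereal_scope.

Definition uniformly_locally_finite E : Prop :=
  forall rho : R, (0 < rho)%R ->
    ereal_sup [set (counting (E `&` `[(x - rho)%R, (x + rho)%R]) : \bar R)
              | x in [set: R]] < +oo.

(* #(E cap [-h, h]) / h ^ alpha, valued in \bar R since `counting` is +oo on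
   infinite sets. *)
Definition counting_ratio alpha E h : \bar R :=
  counting (E `&` `[(- h)%R, h]) * ((h `^ alpha)^-1)%:E.

Definition upper_central_density alpha E : \bar R :=
  limf_esup (counting_ratio alpha E) (+oo%R : set_system R).

Definition lower_central_density alpha E : \bar R :=
  limf_einf (counting_ratio alpha E) (+oo%R : set_system R).

(* min {1, |y| ^ (- s)} with the convention 0 ^ (- s) = +oo; the case y = 0 is
   singled out because the library has 0 `^ (- s) = 0 for s != 0. *)
Definition min1_powRN (s y : R) : R :=
  if y == 0%R then 1%R else Num.min 1%R (`|y| `^ (- s))%R.

(* Unordered sum of a real family of arbitrary sign: `esum` is only meaningful
   for nonnegative terms, so the positive and negative parts are summed
   separately. The difference is the value of the sum when the family is
   summable. *)
Definition signed_esum (D : set R) (u : R -> R) : \bar R :=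
  esum D (EFin \o u)^\+ - esum D (EFin \o u)^\-.

End counting.

(* Main.v *)
Require Import Defs.
From mathcomp Require Import all_boot all_order all_algebra.
From mathcomp Require Import all_classical all_reals all_analysis.
From mathcomp Require Import ring lra.
Set Implicit Arguments.
Unset Strict Implicit.
Unset Printing Implicit Defensive.

Import Order.TTheory GRing.Theory Num.Theory.
Import numFieldNormedType.Exports.
Local Open Scope classical_set_scope.
Local Open Scope ring_scope.

(** Counting the orbit points in [[-h, h]] turns the self-similarity of the orbit
into a renewal equation.  Write [lam i = ln |r i|], [p i = |r i|^(-s)] (so that
the [p i] are weights of sum [1]), [N h] for the number of orbit points in
[[-h, h]], and [Z t = N (e^t) e^(- s t)].  The orbit is the disjoint union of its
images under the maps [f i] and of at most [m] further points, and uniform local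
finiteness makes the translations [b i] harmless: up to an error [O(e^(- s t))],
[Z t] is [\sum_i p i * Z (t - lam i)].

The error is removed by bracketing: for a suitable [offset], [N (h + offset) + 2]
and [N (h - offset)], where [h = e^t], become after multiplication by [e^(- s t)]
exact sub- and supersolutions [X] and [Y] of the renewal equation, with
[Y <= Z <= X] and [X - Y] tending to [0] ([orbit_bracket]).

Each [lam i] is an asymptotic period of [Z], that is, [Z t - Z (t - lam i)] tends
to [0] ([bracket_period]).  Indeed [X t - Y (t - lam i)] is a bounded subsolution;
if its upper limit were positive, it would be nearly attained along a long
progression [t, t - lam i, t - 2 lam i, ...], and the sum along that progression
telescopes, against the boundedness of [X].  Asymptotic periods form a group.

If some [lam i / lam j] is irrational, this group contains arbitrarily small
positive numbers (Dirichlet); as [Z] cannot drop faster than [e^(- s t)], its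
oscillation on long windows tends to [0], and a sub- or supersolution never leaves
the range of its values on one window ([subrenewal_window]), so [Z] satisfies the
Cauchy criterion ([renewal_nonarithmetic]).  If all [|r i|] are powers [rho^(k i)]
with coprime exponents, then [ln rho] is an asymptotic period by Bezout, and the
same argument along each coset of [ln rho] gives convergence of [Z (t + n ln rho)],
uniformly in [t] ([renewal_arithmetic]); the limit is the periodic function of the
second part, and it is positive because [Y] is bounded below.

The value of the limit in the first part comes from the sums
[A t = \sum_(x in O) max (g x - e^(- s t)) 0], where [g x] is [min 1 |x|^(- s)].
They satisfy [A t - \sum_i p i * A (t - lam i) --> V], the bracket of the formula,
with an error [O(e^(- s t))] ([density_defect]), while the increments of [A] are
controlled by [Z] ([cut_sum_increment]): if [Z] is close to [c], then
[A t - A (t - lam i)] is close to [c * s * lam i].  Hence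
[V = c * s * \sum_i p i * lam i].

One estimate serves for the summability of the second sum of the formula and for
the error terms ([variation_usum]): if [G] is nonincreasing with values in
[[0, e]], then [\sum_(x in O) | G |r x + b| - G |r x| |] is at most [C * e] with
[C] independent of [G], since a given level of [G] is crossed between [|r x|] and
[|r x + b|] by boundedly many orbit points only. *)

(** * Sub- and supersolutions of the renewal equation *)
Section renewal.
Context {R : realType} {m : nat} (p lam : 'I_m -> R) (lmin L : R).
Context (p_gt0 : forall i, 0 < p i) (p_sum : \sum_(i < m) p i = 1).
Context (lmin_gt0 : 0 < lmin) (lam_ge : forall i, lmin <= lam i)
  (lam_le : forall i, lam i <= L).

Lemma lag_ge0 : 0 <= L.
Proof.
have [[i _]|m0] := pselect (exists i : 'I_m, True).
  exact: le_trans (ltW lmin_gt0) (le_trans (lam_ge i) (lam_le i)).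
move: p_sum; rewrite big1 => [/eqP|i _]; first by rewrite eq_sym oner_eq0.
by exfalso; apply: m0; exists i.
Qed.

(** Subsolutions of the renewal equation [X t = \sum_i p i * X (t - lam i)];
[Y] is a supersolution when [- Y] is a subsolution. *)
Definition subrenewal (X : R -> R) : Prop :=
  forall t, X t <= \sum_(i < m) p i * X (t - lam i).

Lemma subrenewalD X Y : subrenewal X -> subrenewal Y ->
  subrenewal (fun t => X t + Y t).
Proof.
move=> sX sY t.
under eq_bigr do rewrite mulrDr.
by rewrite big_split lerD.
Qed.

Lemma subrenewal_shift X u : subrenewal X -> subrenewal (fun t => X (t - u)).
Proof.
move=> sX t; apply: le_trans (sX _) _.
by under eq_bigr do rewrite addrAC.
Qed.

(** Maximum principle: a bound on one window of length [L >= max lam] propagates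
to all later times.  The set [Q] allows one to work inside a single coset. *)
Lemma subrenewal_window (Q : set R) X c T : subrenewal X ->
  (forall t i, Q t -> Q (t - lam i)) ->
  (forall t, Q t -> T - L <= t -> t <= T -> X t <= c) ->
  forall t, Q t -> T - L <= t -> X t <= c.
Proof.
move=> sX Qlam win t Qt Tt.
suff H n : forall t, Q t -> T - L <= t -> t <= T + n%:R * lmin -> X t <= c.
  apply: (H (Num.truncn ((t - T) / lmin)).+1) => //.
  rewrite -lerBlDl -ler_pdivrMr //; apply: ltW; exact: truncnS_gt.
elim: n => [|n IH] {Qt Tt}t Qt Tt tn; first by apply: win => //; lra.
have [tT|Tt'] := leP t T; first exact: win.
apply: le_trans (sX t) _; rewrite -[c]mul1r -p_sum mulr_suml.
apply: ler_sum => i _; rewrite ler_pM2l //; apply: IH; first exact: Qlam.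
  by have := lam_le i; lra.
by move: tn; rewrite -natr1 mulrDl mul1r; have := lam_ge i; lra.
Qed.

(** Near its upper limit [l] at infinity, a subsolution at [t] is an average of
values that cannot much exceed [l], so each of these values is near [l] as well;
this is iterated [J] times along the lag [lam i]. *)
Lemma subrenewal_pullback D i (l : R) : subrenewal D ->
  (forall e : R, 0 < e -> exists T : R, forall t, T <= t -> D t <= l + e) ->
  forall J (e : R), 0 < e -> exists2 e', 0 < e' & exists T : R, forall t, T <= t ->
    l - e' <= D t -> forall j, (j <= J)%N -> l - e <= D (t - j%:R * lam i).
Proof.
move=> sD lsup; elim=> [|J IH] e e0.
  exists e => //; exists 0 => t _ Dt j; rewrite leqn0 => /eqP ->.
  by rewrite mul0r subr0.
have [e1 e10 [T1 H1]] := IH _ e0.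
have pi0 := p_gt0 i.
pose e' := Num.min e (p i * e1 / 2).
have e'e : e' <= e by rewrite ge_min lexx.
have e'e1 : e' <= p i * e1 / 2 by rewrite ge_min lexx orbT.
have e'0 : 0 < e' by rewrite lt_min e0 divr_gt0 // mulr_gt0.
have [T2 H2] := lsup _ e'0.
exists e' => //; exists (Num.max (T1 + L) (T2 + L)) => t.
rewrite ge_max => /andP[tT1 tT2] Dt [_|j jJ].
  by rewrite mul0r subr0; lra.
have -> : t - j.+1%:R * lam i = t - lam i - j%:R * lam i.
  by rewrite -natr1; ring.
apply: H1 => //.
  by rewrite lerBrDr; have := lam_le i; lra.
(* All the terms of the average but the [i]-th are at most [l + e']. *)
have : D t <= p i * D (t - lam i) + (1 - p i) * (l + e').
  apply: le_trans (sD t) _; rewrite (bigD1 i) //= lerD2l.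
  have -> : 1 - p i = \sum_(k < m | k != i) p k.
    by rewrite -p_sum [in LHS](bigD1 i) //= addrAC subrr add0r.
  rewrite mulr_suml; apply: ler_sum => k _; rewrite ler_pM2l //.
  by apply: H2; have := lam_le k; lra.
move=> Dle.
rewrite -(ler_pM2l pi0).
have : 0 < p i * e' by rewrite mulr_gt0.
by nra.
Qed.

(** A bounded subsolution that exceeds [e] at arbitrarily large times exceeds
[e / 2] along arbitrarily long progressions of step [lam i]. *)
Lemma subrenewal_recurrent D i (B e T0 : R) : subrenewal D ->
  (forall t, T0 <= t -> D t <= B) -> 0 < e ->
  (forall T, exists2 t, T <= t & e < D t) ->
  forall J T, exists2 t, T <= t &
    forall j, (j <= J)%N -> e / 2 <= D (t - j%:R * lam i).
Proof.
move=> sD DB e0 De J T.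
(* [inf S] is the upper limit of [D] at infinity. *)
pose S : set R := [set x | exists T : R, forall t, T <= t -> D t <= x].
have lbS : lbound S e.
  move=> x [T1 H]; have [t /H tx et] := De T1.
  exact: le_trans (ltW et) tx.
have S0 : S !=set0 by exists B, T0.
have eS : e <= inf S by exact: lb_le_inf.
have hS : has_inf S by split=> //; exists e.
have lsup (d : R) : 0 < d -> exists T : R, forall t, T <= t -> D t <= inf S + d.
  move=> d0; have [x [T1 H] xd] := inf_adherent d0 hS.
  exists T1 => t /H Dx; exact: le_trans Dx (ltW xd).
have [d d0 [T1 H]] := subrenewal_pullback i sD lsup J (divr_gt0 e0 (ltr0n _ 2)).
have [t tT Dt] : exists2 t, Num.max T T1 <= t & inf S - d < D t.
  apply: contrapT => nex.
  have : S (inf S - d).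
    exists (Num.max T T1) => t tT; rewrite leNgt; apply/negP => dt.
    by apply: nex; exists t.
  by move=> /(inf_lbound hS.2); lra.
move: tT; rewrite ge_max => /andP[tT tT1].
exists t => // j jJ; have := H _ tT1 (ltW Dt) _ jJ; lra.
Qed.

(** A subsolution [X] above a supersolution [Y], both bounded from time [t0] on,
whose difference tends to [0]. *)
Definition renewal_bracket (X Y : R -> R) (t0 M : R) : Prop :=
  [/\ subrenewal X, subrenewal (fun t => - Y t),
      forall t, Y t <= X t,
      forall t, t0 <= t -> X t <= M /\ - M <= Y t &
      forall e : R, 0 < e -> exists T : R, forall t, T <= t -> X t - Y t <= e].

Lemma renewal_bracketN X Y t0 M : renewal_bracket X Y t0 M ->
  renewal_bracket (fun t => - Y t) (fun t => - X t) t0 M.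
Proof.
case=> sX sY YX XM XY; split=> //.
- by move=> t; under eq_bigr do rewrite opprK; rewrite opprK; exact: sX.
- by move=> t; rewrite lerN2.
- by move=> t /XM[]; split; lra.
- by move=> e /XY[T H]; exists T => t /H; rewrite opprK addrC.
Qed.

(** The one-sided form of the statement that [lam i] is an asymptotic period. *)
Lemma bracket_lag_le X Y t0 M i : renewal_bracket X Y t0 M ->
  forall e : R, 0 < e -> exists T : R, forall t, T <= t -> X t - Y (t - lam i) <= e.
Proof.
move=> [sX sY YX XM XY] e e0.
apply: contrapT => nex.
pose D t := X t - Y (t - lam i).
have l0 : 0 < lam i by apply: lt_le_trans (lam_ge i).
have sD : subrenewal D.
  by apply: subrenewalD => //; exact: (@subrenewal_shift (fun t => - Y t)).
have DB t : t0 + lam i <= t -> D t <= M + M.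
  move=> tt; have [X1 _] : X t <= M /\ - M <= Y t by apply: XM; lra.
  have [_ Y1] : X (t - lam i) <= M /\ - M <= Y (t - lam i) by apply: XM; lra.
  by rewrite /D; lra.
have De T : exists2 t, T <= t & e < D t.
  apply: contrapT => H; apply: nex; exists T => t tT; rewrite leNgt.
  by apply/negP => et; apply: H; exists t.
have M0 : 0 <= M by have [] := XM _ (lexx t0); have := YX t0; lra.
have [T1 H1] := XY _ (divr_gt0 e0 (ltr0n R 4)).
pose J := (Num.truncn (8 * M / e)).+1.
have [t tT H] := subrenewal_recurrent i sD DB e0 De J
  (Num.max T1 t0 + J%:R * lam i).
(* Each step back by [lam i] lowers [X] by [e / 4] at least. *)
have step j : (j <= J)%N -> X (t - j%:R * lam i) <= X t - j%:R * (e / 4).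
  elim: j => [_|j IH jJ]; first by rewrite !mul0r !subr0.
  have := IH (ltnW jJ); have := H _ (ltnW jJ); rewrite /D.
  have -> : t - j%:R * lam i - lam i = t - j.+1%:R * lam i.
    by rewrite -natr1; ring.
  have := H1 (t - j.+1%:R * lam i) _.
  have -> : T1 <= t - j.+1%:R * lam i.
    rewrite lerBrDr; apply: le_trans tT; apply: lerD.
      by rewrite le_max lexx.
    by rewrite ler_pM2r // ler_nat.
  by move=> /(_ isT); rewrite -natr1; lra.
have := step _ (leqnn J).
have Jl : 0 <= J%:R * lam i by rewrite mulr_ge0 // ltW.
have [Xt _] : X t <= M /\ - M <= Y t.
  by apply: XM; apply: le_trans tT; rewrite -[leLHS]addr0 lerD // le_max lexx orbT.
have [_ Yt] : X (t - J%:R * lam i) <= M /\ - M <= Y (t - J%:R * lam i).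
  by apply: XM; rewrite lerBrDr; apply: le_trans tT; rewrite lerD2r le_max lexx orbT.
have := YX (t - J%:R * lam i).
have : 8 * M / e < J%:R by apply: truncnS_gt.
rewrite ltr_pdivrMr //; lra.
Qed.

(** [tau] is an asymptotic period of [Z] if [Z t - Z (t - tau)] tends to [0] at
infinity. *)
Definition asymptotic_period (Z : R -> R) (tau : R) : Prop :=
  forall e : R, 0 < e -> exists T : R, forall t, T <= t -> `|Z t - Z (t - tau)| <= e.

Lemma bracket_period X Y Z t0 M i : renewal_bracket X Y t0 M ->
  (forall t, Y t <= Z t <= X t) -> asymptotic_period Z (lam i).
Proof.
move=> br YZX e e0.
have [T1 H1] := bracket_lag_le i br e0.
have [T2 H2] := bracket_lag_le i (renewal_bracketN br) e0.
exists (Num.max T1 T2) => t; rewrite ge_max => /andP[/H1 h1 /H2 h2].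
have /andP[] := YZX t; have /andP[] := YZX (t - lam i).
by move=> a1 a2 a3 a4; rewrite ler_norml; apply/andP; split; lra.
Qed.

Lemma asymptotic_period0 Z : asymptotic_period Z 0.
Proof. by move=> e e0; exists 0 => t _; rewrite subr0 subrr normr0 ltW. Qed.

Lemma asymptotic_periodN Z u : asymptotic_period Z u -> asymptotic_period Z (- u).
Proof.
move=> Zu e /Zu[T H]; exists (T - u) => t tT.
have := H (t + u); rewrite addrK opprK distrC; apply; lra.
Qed.

Lemma asymptotic_periodD Z u v :
  asymptotic_period Z u -> asymptotic_period Z v -> asymptotic_period Z (u + v).
Proof.
move=> Zu Zv e e0; have e20 : 0 < e / 2 by rewrite divr_gt0.
have [T1 H1] := Zu _ e20; have [T2 H2] := Zv _ e20.
exists (Num.max T1 (T2 + u)) => t; rewrite ge_max => /andP[t1 t2].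
have h1 := H1 _ t1; have := H2 (t - u); rewrite lerBrDr => /(_ t2) h2.
rewrite opprD addrA.
by apply: le_trans (ler_distD (Z (t - u)) _ _) _; lra.
Qed.

Lemma asymptotic_periodMn Z u n :
  asymptotic_period Z u -> asymptotic_period Z (n%:R * u).
Proof.
move=> Zu; elim: n => [|n IH]; first by rewrite mul0r; exact: asymptotic_period0.
by rewrite -natr1 mulrDl mul1r; exact: asymptotic_periodD.
Qed.

Lemma asymptotic_period_multiples Z u J : asymptotic_period Z u ->
  forall e : R, 0 < e -> exists T : R, forall t, T <= t ->
    forall j, (j <= J)%N -> `|Z t - Z (t - j%:R * u)| <= e.
Proof.
move=> Zu e e0; elim: J => [|J [T1 H1]].
  exists 0 => t _ j; rewrite leqn0 => /eqP ->.
  by rewrite mul0r subr0 subrr normr0 ltW.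
have [T2 H2] := asymptotic_periodMn J.+1 Zu e0.
exists (Num.max T1 T2) => t; rewrite ge_max => /andP[t1 t2] j.
by rewrite leq_eqVlt => /predU1P[->|]; [exact: H2|exact: H1].
Qed.

(** Bounds for the bracket on one window confine every bracketed function from
then on. *)
Lemma bracket_window X Y Z t0 M (Q : set R) T c1 c2 : renewal_bracket X Y t0 M ->
  (forall t, Y t <= Z t <= X t) ->
  (forall t i, Q t -> Q (t - lam i)) ->
  (forall t, Q t -> T - L <= t -> t <= T -> c1 <= Y t /\ X t <= c2) ->
  forall t, Q t -> T - L <= t -> c1 <= Z t /\ Z t <= c2.
Proof.
move=> [sX sY _ _ _] YZX Ql win t Qt Tt; have /andP[Y1 Z1] := YZX t.
have X2 : X t <= c2.
  by apply: subrenewal_window Qt Tt => // u Qu u1 u2; have [] := win u Qu u1 u2.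
suff : - Y t <= - c1 by lra.
apply: (subrenewal_window sY Ql) Qt Tt => u Qu u1 u2.
by have [] := win u Qu u1 u2; lra.
Qed.

(** Arithmetic case: along the cosets of a common divisor [tau] of the lags that
is an asymptotic period, the Cauchy criterion holds uniformly in the coset. *)
Lemma renewal_arithmetic X Y Z t0 M (tau : R) (k : 'I_m -> nat) :
  renewal_bracket X Y t0 M -> (forall t, Y t <= Z t <= X t) ->
  0 < tau -> (forall i, lam i = (k i)%:R * tau) -> asymptotic_period Z tau ->
  forall e : R, 0 < e -> exists T : R, forall t, T <= t -> forall n,
    `|Z (t + n%:R * tau) - Z t| <= e.
Proof.
move=> br YZX tau0 lamk Zt e e0.
pose J := (Num.truncn (L / tau)).+1.
have LJ : L < J%:R * tau by rewrite -ltr_pdivrMr //; exact: truncnS_gt.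
have e20 : 0 < e / 2 by rewrite divr_gt0.
have [T1 H1] := asymptotic_period_multiples J Zt e20.
have [_ _ _ _ XY] := br; have [T2 H2] := XY _ e20.
exists (Num.max T1 (T2 + L)) => t; rewrite ge_max => /andP[tT1 tT2] n.
(* [Q] is the coset of [t] modulo [tau]. *)
pose Q : set R := [set u | exists q, u = t + q.1%:R * tau - q.2%:R * tau].
have Ql u i : Q u -> Q (u - lam i).
  move=> [[q1 q2] /= ->]; exists (q1, (q2 + k i)%N) => /=.
  by rewrite lamk natrD; ring.
have ntau : 0 <= n%:R * tau by rewrite mulr_ge0 // ltW.
suff win u : Q u -> t - L <= u -> u <= t -> Z t - e <= Y u /\ X u <= Z t + e.
  have Qn : Q (t + n%:R * tau) by exists (n, 0%N); rewrite /= mul0r subr0.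
  have tn : t - L <= t + n%:R * tau by have := lag_ge0; lra.
  have [h1 h2] := bracket_window br YZX Ql win Qn tn.
  by rewrite ler_norml; apply/andP; split; lra.
move=> [[q1 q2] /= uE] u1 u2.
have q12 : (q1 <= q2)%N by rewrite -(ler_nat R) -(ler_pM2r tau0); lra.
have uE' : u = t - (q2 - q1)%:R * tau by rewrite uE natrB //; ring.
have qJ : (q2 - q1 <= J)%N.
  by rewrite -(ler_nat R) -(ler_pM2r tau0); apply: ltW; apply: le_lt_trans LJ; lra.
have := H1 _ tT1 _ qJ; rewrite -uE' ler_norml => /andP[h1 h2].
have /andP[h3 h4] := YZX u.
have h5 : X u - Y u <= e / 2 by apply: H2; lra.
by split; lra.
Qed.

(** Non-arithmetic case: with arbitrarily small asymptotic periods, a bracketed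
function that decreases at most exponentially satisfies the Cauchy criterion. *)
Lemma renewal_nonarithmetic X Y Z t0 M (s : R) :
  renewal_bracket X Y t0 M -> (forall t, Y t <= Z t <= X t) -> 0 < s ->
  (forall t, 0 <= Z t) ->
  (forall t u : R, 0 <= u -> expR (- (s * u)) * Z t <= Z (t + u)) ->
  (forall d : R, 0 < d -> exists2 tau : R, 0 < tau < d & asymptotic_period Z tau) ->
  forall e : R, 0 < e -> exists T : R, forall t, T <= t -> forall t', t <= t' ->
    `|Z t' - Z t| <= e.
Proof.
move=> br YZX s0 Z0 Zs small e e0.
have [_ _ YX XM XY] := br.
have M0 : 0 <= M by have [] := XM _ (lexx t0); have := YX t0; lra.
have e40 : 0 < e / 4 by rewrite divr_gt0.
have sM : 0 < s * M + 1 by rewrite ltr_wpDl // mulr_ge0 // ltW.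
have [tau /andP[tau0 taue] Zt] := small _ (divr_gt0 e40 sM).
have {taue} tauM : s * tau * M <= e / 4.
  by move: taue; rewrite ltr_pdivlMr // => ?; nra.
pose J := (Num.truncn (L / tau)).+2.
have LJ : L + tau < J%:R * tau.
  have : L < (Num.truncn (L / tau)).+1%:R * tau.
    by rewrite -ltr_pdivrMr //; exact: truncnS_gt.
  by rewrite /J -(natr1 (Num.truncn _).+1); lra.
have [T1 H1] := asymptotic_period_multiples J Zt e40.
have [T2 H2] := XY _ e40.
(* [Z] loses at most [e / 4] over any time less than [tau]. *)
have slow u d : t0 <= u -> 0 <= d <= tau -> Z u - e / 4 <= Z (u + d).
  move=> tu /andP[d0 dtau]; have := Zs u _ d0.
  have /andP[_ ZX] := YZX u; have [X1 _] := XM _ tu.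
  have := expR_ge1Dx (- (s * d)) => h1 h2.
  have ZM : Z u <= M by lra.
  have h3 : (1 - s * d) * Z u <= Z (u + d).
    by apply: le_trans h2; rewrite ler_wpM2r.
  have h4 : s * d * Z u <= s * tau * M.
    apply: ler_pM => //; first by rewrite mulr_ge0 // ltW.
    by rewrite ler_pM2l.
  by lra.
exists (Num.max T1 (Num.max T2 t0 + L + J%:R * tau)) => t.
rewrite ge_max => /andP[tT1 tT2] t' tt'.
have [T2t t0t] : T2 + L + J%:R * tau <= t /\ t0 + L + J%:R * tau <= t.
  split; apply: le_trans tT2; rewrite !lerD2r le_max lexx //.
  by rewrite orbT.
have Jtau : 0 <= J%:R * tau by rewrite mulr_ge0 // ltW.
suff win u : setT u -> t - L <= u -> u <= t -> Z t - e <= Y u /\ X u <= Z t + e.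
  have tt'L : t - L <= t' by have := lag_ge0; lra.
  have [//|h1 h2] := bracket_window br YZX _ win (I : setT t') tt'L.
  by rewrite ler_norml; apply/andP; split; lra.
move=> _ u1 u2.
(* [u] lies between [t - j.+1 * tau] and [t - j * tau], where [Z] is near [Z t]. *)
pose j := Num.truncn ((t - u) / tau).
have /andP[j1 j2] : j%:R <= (t - u) / tau < j.+1%:R.
  by apply: truncn_itv; apply: divr_ge0; lra.
move: j1 j2; rewrite ler_pdivlMr // ltr_pdivrMr // => j1 j2.
have jJ : (j.+1 <= J)%N.
  rewrite -(ler_nat R) -(ler_pM2r tau0) -natr1 mulrDl mul1r.
  by apply: ltW; apply: le_lt_trans LJ; lra.
have := H1 _ tT1 _ (ltnW jJ); have := H1 _ tT1 _ jJ.
rewrite !ler_norml => /andP[a1 a2] /andP[a3 a4].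
have b1 : Z u - e / 4 <= Z (t - j%:R * tau).
  have -> : t - j%:R * tau = u + (t - j%:R * tau - u) by ring.
  apply: slow; first by lra.
  by move: j2; rewrite -natr1 mulrDl mul1r => j2; apply/andP; split; lra.
have jJt : j.+1%:R * tau <= J%:R * tau by rewrite ler_pM2r // ler_nat.
have b2 : Z (t - j.+1%:R * tau) - e / 4 <= Z u.
  have -> : u = t - j.+1%:R * tau + (u - (t - j.+1%:R * tau)) by ring.
  apply: slow; first by lra.
  by move: j2; rewrite -natr1 mulrDl mul1r => j2; apply/andP; split; lra.
have /andP[h3 h4] := YZX u.
have h5 : X u - Y u <= e / 4 by apply: H2; lra.
by split; lra.
Qed.

End renewal.

(** * Asymptotic periods generated by two or more lags *)
Section periods.
Context {R : realType}.

Lemma rational_natdiv (k l : nat) : rational (l%:R / k%:R : R).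
Proof. by exists (l%:R / k%:R) => //; rewrite fmorph_div !rmorph_nat. Qed.

(** Dirichlet's theorem, by the pigeonhole principle: two of the fractional parts
of [k * (x / y)], [k <= n], lie in the same interval [[j / n, (j + 1) / n)]. *)
Lemma irrational_small_combination (x y d : R) : 0 < x -> 0 < y ->
  irrational (x / y) -> 0 < d ->
  exists k l : nat, 0 < `|k%:R * x - l%:R * y| < d.
Proof.
move=> x0 y0 irr d0.
pose n := (Num.truncn (y / d)).+1.
have n0 : 0 < n%:R :> R by rewrite ltr0n.
have ynd : y / n%:R < d.
  by rewrite ltr_pdivrMr // mulrC -ltr_pdivrMr //; exact: truncnS_gt.
pose q k : R := k%:R * (x / y).
have q0 k : 0 <= q k by rewrite mulr_ge0 // ltW // divr_gt0.
pose fr k : R := q k - (Num.truncn (q k))%:R.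
have fr01 k : 0 <= fr k < 1.
  have /andP[] := truncn_itv (q0 k); rewrite -natr1 /fr => ? ?.
  by apply/andP; split; lra.
have nfr0 k : 0 <= n%:R * fr k.
  by have /andP[? _] := fr01 k; rewrite mulr_ge0 // ltW.
have box_lt k : (Num.truncn (n%:R * fr k) < n)%N.
  by rewrite truncn_lt_nat // gtr_pMr //; have /andP[] := fr01 k.
pose box (k : 'I_n.+1) : 'I_n := Ordinal (box_lt k).
have /injectivePn[i [j ij eij]] : ~~ injectiveb box.
  apply/negP => /injectiveP /leq_card; rewrite !card_ord ltnn //.
wlog lij : i j ij eij / (i < j)%N.
  move=> wl; have := ij; rewrite neq_ltn => /orP[h|h]; first exact: wl h.
  by apply: (wl j i) => //; rewrite eq_sym.
have {}eij : Num.truncn (n%:R * fr i) = Num.truncn (n%:R * fr j).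
  by have := congr1 (@nat_of_ord _) eij.
exists (j - i)%N, (Num.truncn (q j) - Num.truncn (q i))%N.
have tij : (Num.truncn (q i) <= Num.truncn (q j))%N.
  apply: le_truncn; apply: ler_wpM2r; first exact: ltW (divr_gt0 x0 y0).
  by rewrite ler_nat ltnW.
have E : (j - i)%:R * x - (Num.truncn (q j) - Num.truncn (q i))%:R * y =
    y * (fr j - fr i).
  rewrite !natrB // ?(ltnW lij) // /fr /q; field; exact: lt0r_neq0.
apply/andP; split.
  rewrite normr_gt0 subr_eq0; apply/eqP => e0; apply: irr.
  have -> : x / y = (Num.truncn (q j) - Num.truncn (q i))%:R / (j - i)%:R.
    apply/eqP; rewrite eqr_div ?lt0r_neq0 // ?ltr0n ?subn_gt0 //.
    by rewrite mulrC e0.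
  exact: rational_natdiv.
rewrite E normrM gtr0_norm //; apply: le_lt_trans ynd.
rewrite ler_pM2l // ler_norml.
have /andP[a1 a2] := truncn_itv (nfr0 i).
have /andP[b1 b2] := truncn_itv (nfr0 j).
rewrite eij -natr1 in a1 a2; rewrite -natr1 in b2.
have nV : n%:R * n%:R^-1 = 1 :> R by rewrite mulfV // lt0r_neq0.
by apply/andP; split; rewrite -(ler_pM2l n0) ?mulrN nV; lra.
Qed.

Lemma asymptotic_period_small (Z : R -> R) (x y d : R) : 0 < x -> 0 < y ->
  irrational (x / y) -> asymptotic_period Z x -> asymptotic_period Z y ->
  0 < d -> exists2 tau : R, 0 < tau < d & asymptotic_period Z tau.
Proof.
move=> x0 y0 irr Zx Zy d0.
have [k [l]] := irrational_small_combination x0 y0 irr d0.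
have P : asymptotic_period Z (k%:R * x - l%:R * y).
  apply: asymptotic_periodD; first exact: asymptotic_periodMn.
  exact/asymptotic_periodN/asymptotic_periodMn.
case: ger0P => _ h; first by exists (k%:R * x - l%:R * y).
by exists (- (k%:R * x - l%:R * y)) => //; exact: asymptotic_periodN.
Qed.

Lemma asymptotic_period_gcdn (Z : R -> R) (u : R) (k l : nat) :
  asymptotic_period Z (k%:R * u) -> asymptotic_period Z (l%:R * u) ->
  asymptotic_period Z ((gcdn k l)%:R * u).
Proof.
move=> Zk Zl; have [->|k0] := posnP k; first by rewrite gcd0n.
case: (egcdnP l k0) => km kn E _.
have -> : (gcdn k l)%:R * u = km%:R * (k%:R * u) - kn%:R * (l%:R * u).
  by rewrite !mulrA -!natrM E natrD; ring.
apply: asymptotic_periodD; first exact: asymptotic_periodMn.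
exact/asymptotic_periodN/asymptotic_periodMn.
Qed.

Lemma asymptotic_period_biggcdn (Z : R -> R) (u : R) m (k : 'I_m -> nat) :
  (forall i, asymptotic_period Z ((k i)%:R * u)) ->
  asymptotic_period Z ((\big[gcdn/0%N]_(i < m) k i)%:R * u).
Proof.
move=> Zk; pose P n := asymptotic_period Z (n%:R * u).
apply: (big_ind P) => [|n n'|i _]; last exact: Zk.
  by rewrite /P mul0r; exact: asymptotic_period0.
exact: asymptotic_period_gcdn.
Qed.

End periods.

(** * Unordered sums of real families *)
Section unordered_sum.
Context {R : realType}.
Implicit Types (D : set R) (u v : R -> R).

(** The sum of the real family [u] over [D], as a real number; it is meaningful
when the family is summable, and then [usum] is linear. *)
Definition usum D u : R := fine (signed_esum D u).

(** Absolute summability of a real family. *)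
Definition usummable D u : Prop := summable D (EFin \o u).

Lemma usummable_lty D u : (forall x, D x -> 0 <= u x) ->
  usummable D u = (\esum_(x in D) (u x)%:E < +oo)%E.
Proof.
move=> u0; rewrite /usummable /summable; congr (is_true (_ < _)%E).
by apply: eq_esum => x Dx /=; rewrite ger0_norm // u0.
Qed.

Lemma le_usummable D u v : (forall x, D x -> `|u x| <= v x) ->
  usummable D v -> usummable D u.
Proof.
move=> uv; apply: le_lt_trans; apply: le_esum => x Dx /=.
by rewrite lee_fin (le_trans (uv x Dx)) // ler_norm.
Qed.

Lemma eq_usummable D u v : (forall x, D x -> u x = v x) ->
  usummable D v -> usummable D u.
Proof.
move=> uv; rewrite /usummable /summable; congr (is_true (_ < _)%E).
by apply: eq_esum => x Dx /=; rewrite uv.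
Qed.

Lemma usummable_abs D u : usummable D u -> usummable D (fun x => `|u x|).
Proof.
rewrite /usummable /summable; congr (is_true (_ < _)%E).
by apply: eq_esum => x Dx /=; rewrite normr_id.
Qed.

Lemma usummableD D u v : usummable D u -> usummable D v ->
  usummable D (fun x => u x + v x).
Proof. by move=> su sv; exact: (summableD su sv). Qed.

Lemma usummableN D u : usummable D u -> usummable D (fun x => - u x).
Proof.
by move=> su; apply: le_usummable (usummable_abs su) => x _; rewrite normrN.
Qed.

Lemma usummableB D u v : usummable D u -> usummable D v ->
  usummable D (fun x => u x - v x).
Proof. by move=> su sv; exact: (summableB su sv). Qed.

Lemma usummable_sum D (I : Type) (r : seq I) (F : I -> R -> R) :
  (forall i, usummable D (F i)) -> usummable D (fun x => \sum_(i <- r) F i x).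
Proof.
move=> sF; elim: r => [|i r IH].
  rewrite /usummable /summable esum1 // => x _ /=.
  by rewrite big_nil normr0.
apply: (@eq_usummable _ _ (fun x => F i x + \sum_(i <- r) F i x)).
  by move=> x _; rewrite big_cons.
exact: usummableD.
Qed.

Lemma usummableZ D (c : R) u : usummable D u -> usummable D (fun x => c * u x).
Proof.
move=> su; pose n := (Num.truncn `|c|).+1.
apply: le_usummable (usummable_sum (nseq n tt) (fun _ => usummable_abs su)) => x _.
rewrite big_const_seq count_predT size_nseq iter_addr addr0 -mulr_natl normrM.
by rewrite ler_wpM2r // ltW // truncnS_gt.
Qed.

Lemma signed_esum_ge0 D u : (forall x, D x -> 0 <= u x) ->
  signed_esum D u = \esum_(x in D) (u x)%:E.
Proof.
move=> u0; rewrite /signed_esum [X in (_ - X)%E]esum1 ?sube0.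
  by apply: eq_esum => x Dx; rewrite funeposE /= max_l // lee_fin u0.
by move=> x Dx; rewrite funenegE /= max_r // lee_fin oppr_le0 u0.
Qed.

Lemma signed_esumE D u : usummable D u -> signed_esum D u = (usum D u)%:E.
Proof.
move=> su; rewrite /usum fineK // /signed_esum fin_numB; apply/andP; split.
  rewrite (_ : esum _ _ = \esum_(x in D) `| (EFin \o u)^\+ x |%E).
    by rewrite -summableE; exact: summable_funepos.
  by apply: eq_esum => x _; rewrite gee0_abs.
rewrite (_ : esum _ _ = \esum_(x in D) `| (EFin \o u)^\- x |%E).
  by rewrite -summableE; exact: summable_funeneg.
by apply: eq_esum => x _; rewrite gee0_abs.
Qed.

Lemma esum_usum D u : (forall x, D x -> 0 <= u x) -> usummable D u ->
  \esum_(x in D) (u x)%:E = (usum D u)%:E.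
Proof. by move=> u0 su; rewrite -signed_esum_ge0 // signed_esumE. Qed.

Lemma eq_usum D u v : (forall x, D x -> u x = v x) -> usum D u = usum D v.
Proof.
move=> uv; rewrite /usum /signed_esum; congr (fine (_ - _)%E);
  by apply: eq_esum => x Dx; rewrite ?funeposE ?funenegE /= uv.
Qed.

Lemma usumD_ge0 D u v : (forall x, D x -> 0 <= u x) -> (forall x, D x -> 0 <= v x) ->
  usummable D u -> usummable D v ->
  usum D (fun x => u x + v x) = usum D u + usum D v.
Proof.
move=> u0 v0 su sv; apply: EFin_inj.
rewrite EFinD -!esum_usum //;
  [|by move=> x Dx; rewrite addr_ge0 ?u0 ?v0|exact: usummableD].
by rewrite -esumD // => x Dx; rewrite lee_fin ?u0 ?v0.
Qed.

Lemma usumB_ge0 D u v : (forall x, D x -> 0 <= u x) -> (forall x, D x -> 0 <= v x) ->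
  usummable D u -> usummable D v ->
  usum D (fun x => u x - v x) = usum D u - usum D v.
Proof.
move=> u0 v0 su sv; apply: EFin_inj.
rewrite EFinB -(esum_usum u0 su) -(esum_usum v0 sv).
rewrite -signed_esumE; last exact: usummableB.
by rewrite -esumB // => x Dx; rewrite /= lee_fin ?u0 ?v0.
Qed.

Lemma usumD D u v : usummable D u -> usummable D v ->
  usum D (fun x => u x + v x) = usum D u + usum D v.
Proof.
move=> su sv.
(* Both families are split into positive and negative parts. *)
have half w : usummable D w ->
    [/\ usummable D (fun x => Num.max (w x) 0),
        usummable D (fun x => Num.max (- w x) 0) &
        usum D w = usum D (fun x => Num.max (w x) 0) -
                   usum D (fun x => Num.max (- w x) 0)].
  move=> sw.
  have s1 : usummable D (fun x => Num.max (w x) 0).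
    apply: le_usummable (usummable_abs sw) => x _ /=.
    by rewrite ger0_norm ?le_max ?lexx ?orbT // ge_max ler_norm normr_ge0.
  have s2 : usummable D (fun x => Num.max (- w x) 0).
    apply: le_usummable (usummable_abs sw) => x _ /=.
    rewrite ger0_norm ?le_max ?lexx ?orbT // ge_max normr_ge0 andbT.
    by rewrite -normrN ler_norm.
  split=> //; rewrite -usumB_ge0 //; try by move=> x _; rewrite le_max lexx orbT.
  apply: eq_usum => x _; have [w0|w0] := leP 0 (w x).
    by rewrite max_r ?subr0 // oppr_le0.
  by rewrite max_l ?oppr_ge0 ?ltW // sub0r opprK.
have [u1 u2 uE] := half u su; have [v1 v2 vE] := half v sv.
rewrite uE vE.
rewrite (@eq_usum _ _ (fun x => (Num.max (u x) 0 + Num.max (v x) 0)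
                        - (Num.max (- u x) 0 + Num.max (- v x) 0))).
  rewrite usumB_ge0; try exact: usummableD;
    try by move=> x _; rewrite addr_ge0 // le_max lexx orbT.
  rewrite !usumD_ge0 //; try by move=> x _; rewrite le_max lexx orbT.
  by ring.
have maxB (w : R) : w = Num.max w 0 - Num.max (- w) 0.
  have [w0|w0] := leP 0 w.
    by rewrite max_r ?subr0 // oppr_le0.
  by rewrite max_l ?oppr_ge0 ?ltW // sub0r opprK.
by move=> x _; rewrite [u x in LHS]maxB [v x in LHS]maxB; ring.
Qed.

Lemma usum0 D u : (forall x, D x -> u x = 0) -> usum D u = 0.
Proof.
move=> u0; apply: EFin_inj; rewrite -esum_usum.
- by rewrite esum1 // => x Dx; rewrite u0.
- by move=> x Dx; rewrite u0.
- by rewrite /usummable /summable esum1 // => x Dx; rewrite /= u0 // normr0.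
Qed.

Lemma usumN D u : usummable D u -> usum D (fun x => - u x) = - usum D u.
Proof.
move=> su; apply/eqP; rewrite -addr_eq0 -usumD //; last exact: usummableN.
by apply/eqP/usum0 => x _; rewrite addNr.
Qed.

Lemma usumB D u v : usummable D u -> usummable D v ->
  usum D (fun x => u x - v x) = usum D u - usum D v.
Proof.
by move=> su sv; rewrite usumD ?usumN //; exact: usummableN.
Qed.

Lemma usum_sum D (I : Type) (r : seq I) (F : I -> R -> R) :
  (forall i, usummable D (F i)) ->
  usum D (fun x => \sum_(i <- r) F i x) = \sum_(i <- r) usum D (F i).
Proof.
move=> sF; elim: r => [|i r IH].
  by rewrite big_nil; apply: usum0 => x _; rewrite big_nil.
rewrite big_cons -IH -usumD //; last exact: usummable_sum.
by apply: eq_usum => x _; rewrite big_cons.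
Qed.

Lemma usum_ge0 D u : (forall x, D x -> 0 <= u x) -> 0 <= usum D u.
Proof.
by move=> u0; apply: fine_ge0; rewrite signed_esum_ge0 //; exact: esum_ge0.
Qed.

Lemma le_usum D u v : usummable D u -> usummable D v ->
  (forall x, D x -> u x <= v x) -> usum D u <= usum D v.
Proof.
move=> su sv uv; rewrite -subr_ge0 -usumB //; apply: usum_ge0 => x Dx.
by rewrite subr_ge0 uv.
Qed.

Lemma ler_norm_usum D u : usummable D u ->
  `|usum D u| <= usum D (fun x => `|u x|).
Proof.
move=> su; have sa := usummable_abs su.
rewrite ler_norml -usumN //; apply/andP; split; apply: le_usum => //.
- exact: usummableN.
- by move=> x _; rewrite lerNl -normrN ler_norm.
- by move=> x _; exact: ler_norm.
Qed.

Lemma esumZ D u (c : R) : 0 < c ->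
  \esum_(x in D) (c * u x)%:E = (c%:E * \esum_(x in D) (u x)%:E)%E.
Proof.
(* Applied to [c], then to [c^-1], this gives both inequalities. *)
have le1 (d : R) w : 0 < d ->
    (\esum_(x in D) (d * w x)%:E <= d%:E * \esum_(x in D) (w x)%:E)%E.
  move=> d0; apply: ge_ereal_sup => _ [A [finA AD] <-].
  rewrite fsbig_finite //= sumEFin -mulr_sumr EFinM -sumEFin.
  rewrite lee_pmul2l // ?lte_fin //; apply: ereal_sup_ubound.
  by exists A => //; rewrite fsbig_finite.
move=> c0; apply/eqP; rewrite eq_le le1 //=.
rewrite -lee_pdivlMl //.
apply: le_trans (le1 _ _ _); last by rewrite invr_gt0.
by apply: le_esum => x _; rewrite mulKf // lt0r_neq0.
Qed.

Lemma usumZ_gt0 D u (c : R) : 0 < c -> (forall x, D x -> 0 <= u x) ->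
  usum D (fun x => c * u x) = c * usum D u.
Proof.
move=> c0 u0; rewrite /usum !signed_esum_ge0 //; last first.
  by move=> x Dx; rewrite mulr_ge0 ?u0 // ltW.
rewrite esumZ //; have : (0 <= \esum_(x in D) (u x)%:E)%E.
  by apply: esum_ge0 => x Dx; rewrite lee_fin u0.
case: (\esum_(x in D) (u x)%:E)%E => [z| |] //= _.
by rewrite gt0_muley ?lte_fin //= mulr0.
Qed.

Lemma usumZ D u (c : R) : 0 <= c -> (forall x, D x -> 0 <= u x) ->
  usum D (fun x => c * u x) = c * usum D u.
Proof.
rewrite le_eqVlt => /predU1P[<- _|]; last exact: usumZ_gt0.
by rewrite mul0r; apply: usum0 => x _; rewrite mul0r.
Qed.

Lemma usum_setI D E u :
  usum (D `&` E) u = usum D (fun x => if x \in E then u x else 0).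
Proof.
rewrite /usum /signed_esum !esum_mkcondr.
by congr (fine (_ - _)%E); apply: eq_esum => x _; rewrite ?funeposE ?funenegE /=;
  case: ifP; rewrite ?oppr0 ?maxxx.
Qed.

Lemma usummable_setI D E u : usummable D u -> usummable (D `&` E) u.
Proof.
rewrite /usummable /summable; apply: le_lt_trans; rewrite esum_mkcondr.
by apply: le_esum => x _; case: ifP => // _; rewrite abse_ge0.
Qed.

End unordered_sum.

(** * Counting by summation of indicators *)
Section counting_sums.
Context {R : realType}.
Implicit Types (D A : set R) (P : pred R).

Lemma counting_esum A : finite_set A ->
  counting A = \esum_(x in A) (1%:E : \bar R).
Proof.
move=> finA; rewrite /counting asboolT // esum_fset // fsbig_finite //= sumEFin.
congr (_%:E).
by rewrite big_const_seq count_predT iter_addr addr0.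
Qed.

(** Indicators enter sums as booleans cast to [nat], then to [R]. *)
Lemma counting_usum D P : (counting (D `&` [set x | P x]) < (+oo : \bar R))%E ->
  usummable D (fun x => (P x)%:R : R) /\
  counting (D `&` [set x | P x]) = (usum D (fun x => (P x)%:R))%:E.
Proof.
move=> cP; have finP : finite_set (D `&` [set x | P x]).
  by move: cP; rewrite /counting; case: ifPn => // /asboolP.
have E : counting (D `&` [set x | P x]) = \esum_(x in D) ((P x)%:R : R)%:E.
  rewrite counting_esum // esum_mkcondr; apply: eq_esum => x _.
  have -> : (x \in [set x | P x]) = P x by apply/idP/idP; rewrite inE.
  by case: (P x).
have sP : usummable D (fun x => (P x)%:R : R).
  by rewrite usummable_lty -?E // => x _; rewrite ler0n.
by split => //; rewrite E esum_usum // => x _; rewrite ler0n.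
Qed.

Lemma uniformly_locally_finite_usum D : uniformly_locally_finite D ->
  forall rho : R, 0 < rho -> exists C : R, forall x : R,
    usummable D (fun y => (`|y - x| <= rho)%R%:R) /\
    usum D (fun y => (`|y - x| <= rho)%R%:R) <= C.
Proof.
move=> ulf rho rho0; have := ulf rho rho0.
set S := ereal_sup _ => Soo.
have S0 : (0 <= S)%E.
  apply: le_trans (ereal_sup_ubound _); last by exists 0.
  by rewrite /counting; case: ifP.
exists (fine S) => x.
have fS : S \is a fin_num by rewrite ge0_fin_numE.
have E : D `&` `[x - rho, x + rho] = D `&` [set y | `|y - x| <= rho].
  by congr (_ `&` _); apply/seteqP; split=> y; rewrite /= in_itv /= ler_distl.
have cS : (counting (D `&` [set y | (`|y - x| <= rho)%R]) <= S)%E.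
  by rewrite -E; apply: ereal_sup_ubound; exists x.
have [sx cx] := @counting_usum D (fun y => `|y - x| <= rho) (le_lt_trans cS Soo).
by split => //; rewrite -lee_fin -cx fineK.
Qed.

Lemma sum_fset_le_usum D (A : set R) (u : R -> R) : finite_set A -> A `<=` D ->
  (forall x, D x -> 0 <= u x) -> usummable D u ->
  \sum_(x \in A) u x <= usum D u.
Proof.
move=> finA AD u0 su; rewrite -lee_fin -esum_usum // fsbig_finite //= -sumEFin.
by apply: ereal_sup_ubound; exists A => //; rewrite fsbig_finite.
Qed.

End counting_sums.

(** * Total variation along a uniformly locally finite set *)
Section variation.
Context {R : realType}.
Implicit Types (D : set R) (G : R -> R).

(** Telescoping: only [J] values of [g] survive at each end. *)
Lemma sum_lag_le (g : nat -> R) (eta : R) n J : (forall k, 0 <= g k <= eta) ->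
  \sum_(0 <= k < n) (g k - g (k + J)%N) <= J%:R * eta.
Proof.
move=> g01; elim: J => [|J IH].
  by rewrite mul0r big1_seq // => k _; rewrite addn0 subrr.
rewrite (eq_bigr (fun k => (g k - g (k + J)%N) - (g (k + J).+1 - g (k + J)%N))).
  rewrite sumrB -natr1 mulrDl mul1r; apply: lerD => //.
  rewrite (@telescope_sumr _ 0 n (fun k => g (k + J)%N)) // add0n.
  by have /andP[? _] := g01 (n + J)%N; have /andP[_ ?] := g01 J; lra.
by move=> k _; rewrite addnS; ring.
Qed.

(** Monotone functions [G] with values in [[0, eta]] vary by at most [C * eta] in
total between [|r * x|] and [|r * x + b|], where [C] depends neither on [G] nor on
[eta].  The points [x] with [|r * x|] in [[k, k + 1)] are boundedly many, and each
contributes at most [G (k - B) - G (k + 1 + B)], where [B >= |b|]; the sum over [k]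
telescopes. *)
Lemma variation_usum D (r b : R) : uniformly_locally_finite D -> 1 < `|r| ->
  exists2 C, 0 <= C & forall G (eta : R), {homo G : x y / x <= y >-> y <= x} ->
    (forall x, 0 <= G x <= eta) ->
    usummable D (fun x => G `|r * x + b| - G `|r * x|) /\
    usum D (fun x => `|G `|r * x + b| - G `|r * x| |) <= C * eta.
Proof.
move=> ulf r1; have [C1 HC1] := uniformly_locally_finite_usum ulf ltr01.
have C10 : 0 <= C1.
  by have [_] := HC1 0; apply: le_trans; apply: usum_ge0 => y _; rewrite ler0n.
pose B := (Num.truncn `|b|).+1.
have bB : `|b| < B%:R by exact: truncnS_gt.
pose J := (B + B).+1.
exists (2 * C1 * J%:R) => [|G eta Gdec G01]; first by rewrite !mulr_ge0.
have eta0 : 0 <= eta by have /andP[? ?] := G01 0; lra.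
pose v x := `|G `|r * x + b| - G `|r * x| |.
pose kk x := Num.truncn `|r * x|.
pose g (k : nat) := G (k%:R - B%:R).
have v_le x : v x <= g (kk x) - g (kk x + J)%N.
  have /andP[k1 k2] := truncn_itv (normr_ge0 (r * x)); rewrite -/(kk x) in k1 k2.
  have n1 : `|r * x + b| <= `|r * x| + `|b| := ler_normD _ _.
  have n2 : `|r * x| - `|b| <= `|r * x + b|.
    by have := ler_normB (r * x + b) b; rewrite addrK; lra.
  have gE : (kk x + J)%:R - B%:R = (kk x)%:R + 1 + B%:R :> R.
    by rewrite /J natrD -natr1 natrD; ring.
  rewrite -natr1 in k2; rewrite /v /g gE.
  have h1 : G `|r * x| <= G ((kk x)%:R - B%:R).
    by apply: Gdec; have := normr_ge0 b; lra.
  have h2 : G `|r * x + b| <= G ((kk x)%:R - B%:R) by apply: Gdec; lra.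
  have h3 : G ((kk x)%:R + 1 + B%:R) <= G `|r * x|.
    by apply: Gdec; have := normr_ge0 b; lra.
  have h4 : G ((kk x)%:R + 1 + B%:R) <= G `|r * x + b| by apply: Gdec; lra.
  by rewrite ler_norml; apply/andP; split; lra.
have g_dec k : 0 <= g k - g (k + J)%N.
  by rewrite subr_ge0; apply: Gdec; rewrite lerD2r ler_nat leq_addr.
(* As [|r| > 1], such points lie within distance [1] of [k / r] or [- k / r]. *)
pose in_ball (c x : R) : R := (`|x - c| <= 1)%R%:R.
have kk_in_ball k x : (kk x == k)%:R <= in_ball (k%:R / r) x + in_ball (- (k%:R / r)) x.
  have b0 c : 0 <= in_ball c x by rewrite ler0n.
  case: eqP => [<-|_]; last by rewrite addr_ge0.
  have /andP[k1 k2] := truncn_itv (normr_ge0 (r * x)); rewrite -/(kk x) in k1 k2.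
  rewrite -natr1 in k2.
  have r0 : r != 0 by rewrite -normr_gt0 (lt_trans _ r1).
  have le1 (y : R) : `|r * y| <= 1 -> `|y| <= 1.
    by rewrite normrM => h; have := normr_ge0 y; nra.
  have [rx0|rx0] := leP 0 (r * x).
    rewrite (ger0_norm rx0) in k1 k2.
    suff -> : in_ball ((kk x)%:R / r) x = 1 by rewrite lerDl.
    rewrite /in_ball le1 // mulrBr mulrCA divff // mulr1.
    by rewrite ler_norml; apply/andP; split; lra.
  rewrite (ltr0_norm rx0) in k1 k2.
  suff -> : in_ball (- ((kk x)%:R / r)) x = 1 by rewrite lerDr.
  rewrite /in_ball le1 // opprK mulrDr mulrCA divff // mulr1.
  by rewrite ler_norml; apply/andP; split; lra.
have fin_le A : finite_set A -> A `<=` D ->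
    \sum_(x \in A) v x <= 2 * C1 * J%:R * eta.
  move=> finA AD; rewrite fsbig_finite //=.
  set t := (finmap.enum_fset _).
  pose n := (\max_(x <- t) kk x).+1.
  have kn x : x \in t -> (kk x < n)%N by move=> xt; rewrite ltnS leq_bigmax_seq.
  apply: (@le_trans _ _ (\sum_(x <- t) \sum_(0 <= k < n)
           (kk x == k)%:R * (g k - g (k + J)%N))).
    rewrite big_seq [leRHS]big_seq; apply: ler_sum => x /kn xn.
    rewrite big_mkord (bigD1 (Ordinal xn)) //= eqxx mul1r.
    apply: le_trans (v_le x) _; rewrite lerDl sumr_ge0 // => k _.
    by rewrite mulr_ge0 // ler0n.
  rewrite exchange_big /=.
  apply: (@le_trans _ _ (\sum_(0 <= k < n) (2 * C1) * (g k - g (k + J)%N))).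
    apply: ler_sum => k _; rewrite -mulr_suml ler_wpM2r //.
    have [s1 c1] := HC1 (k%:R / r); have [s2 c2] := HC1 (- (k%:R / r)).
    apply: (@le_trans _ _
      (\sum_(x <- t) (in_ball (k%:R / r) x + in_ball (- (k%:R / r)) x))).
      by apply: ler_sum => x _; exact: kk_in_ball.
    have := @sum_fset_le_usum _ D A
      (fun x => in_ball (k%:R / r) x + in_ball (- (k%:R / r)) x) finA AD.
    rewrite fsbig_finite //= -/t => /(_ _ _).
    move=> /(_ (fun x _ => addr_ge0 (ler0n _ _) (ler0n _ _)) (usummableD s1 s2)).
    by move=> /le_trans; apply; rewrite usumD //; lra.
  rewrite -mulr_sumr -[leRHS]mulrA; apply: ler_wpM2l; first by rewrite mulr_ge0.
  by apply: sum_lag_le => k; exact: G01.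
have esum_le : (\esum_(x in D) (v x)%:E <= (2 * C1 * J%:R * eta)%:E)%E.
  apply: ge_ereal_sup => _ [A [finA AD] <-].
  have := fin_le A finA AD; rewrite !fsbig_finite //= sumEFin lee_fin.
  by [].
have sv : usummable D v.
  by rewrite usummable_lty ?(le_lt_trans esum_le) ?ltry // => x _; exact: normr_ge0.
split; first by apply: le_usummable sv => x _.
by rewrite -lee_fin -esum_usum // => x _; exact: normr_ge0.
Qed.

End variation.

(** * Functions with quadratic increments *)
Section increments.
Context {R : realType}.

(** Cutting [[t, t']] into [n] equal steps bounds [F t' - F t] by
[K * (t' - t) ^+ 2 / n]. *)
Lemma nonincreasing_of_quadratic_increments (F : R -> R) (K d0 T : R) :
  0 <= K -> 0 < d0 ->
  (forall t d, T <= t -> 0 <= d <= d0 -> F (t + d) - F t <= K * d ^+ 2) ->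
  forall t t', T <= t -> t <= t' -> F t' <= F t.
Proof.
move=> K0 d00 HF t t' Tt tt'; rewrite leNgt; apply/negP => Flt.
set e := F t' - F t; have e0 : 0 < e by rewrite subr_gt0.
set D := t' - t; have D0 : 0 <= D by rewrite subr_ge0.
pose n := (Num.truncn (D / d0 + K * D ^+ 2 / e)).+1.
have n0 : 0 < n%:R :> R by rewrite ltr0n.
have : D / d0 + K * D ^+ 2 / e < n%:R := truncnS_gt _.
have P1 : 0 <= D / d0 by rewrite divr_ge0 // ltW.
have P2 : 0 <= K * D ^+ 2 / e by rewrite divr_ge0 ?mulr_ge0 ?sqr_ge0 // ltW.
move=> Hn.
have n1 : D < d0 * n%:R by rewrite mulrC -ltr_pdivrMr //; lra.
have n2 : K * D ^+ 2 < e * n%:R by rewrite [ltRHS]mulrC -ltr_pdivrMr //; lra.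
pose d := D / n%:R.
have d_ge0 : 0 <= d by rewrite divr_ge0 // ltW.
have d_le : d <= d0 by rewrite ler_pdivrMr // ltW.
have nd : n%:R * d = D by rewrite /d mulrCA divff ?mulr1 // lt0r_neq0.
have step k : F (t + k%:R * d) <= F t + k%:R * (K * d ^+ 2).
  elim: k => [|k IH]; first by rewrite !mul0r !addr0.
  have kd : 0 <= k%:R * d by rewrite mulr_ge0.
  have := HF (t + k%:R * d) d; rewrite d_ge0 d_le.
  have -> : t + k%:R * d + d = t + k.+1%:R * d by rewrite -natr1; ring.
  have -> : T <= t + k%:R * d by lra.
  by move=> /(_ isT isT); rewrite -natr1; lra.
have := step n; rewrite nd (_ : t + D = t'); last by rewrite /D; ring.
have -> : n%:R * (K * d ^+ 2) = K * D ^+ 2 / n%:R.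
  by rewrite -nd; field; exact: lt0r_neq0.
move=> h; have : e <= K * D ^+ 2 / n%:R by rewrite /e; lra.
by rewrite ler_pdivlMr // leNgt n2.
Qed.

Lemma expRN_le_quadratic (x : R) : 0 <= x -> expR (- x) <= 1 - x + x ^+ 2.
Proof.
move=> x0; have h := expR_ge1Dx x.
have e0 := expR_gt0 (- x); have E : expR (- x) * expR x = 1.
  by rewrite -expRD addNr expR0.
have x3 : 0 <= x ^+ 3 by rewrite exprn_ge0.
have x1 : 0 < 1 + x by lra.
have h1 : expR (- x) * (1 + x) <= 1 by rewrite -[leRHS]E ler_pM2l.
rewrite -(ler_pM2r x1); apply: (le_trans h1).
have -> : (1 - x + x ^+ 2) * (1 + x) = 1 + x ^+ 3 by ring.
lra.
Qed.

Lemma expR_le_quadratic (x : R) : 0 <= x -> x <= 2^-1 ->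
  expR x <= 1 + x + 2 * x ^+ 2.
Proof.
move=> x0 x2; have h := expR_ge1Dx (- x).
have e0 := expR_gt0 x; have E : expR x * expR (- x) = 1.
  by rewrite -expRD subrr expR0.
have x1 : 0 < 1 - x by lra.
have h1 : expR x * (1 - x) <= 1 by rewrite -[leRHS]E ler_pM2l.
rewrite -(ler_pM2r x1); apply: (le_trans h1).
have -> : (1 + x + 2 * x ^+ 2) * (1 - x) = 1 + x ^+ 2 * (1 - 2 * x) by ring.
by rewrite lerDl mulr_ge0 ?sqr_ge0 //; lra.
Qed.

End increments.

(** * The orbit and its decomposition *)
Section orbit.
Context {R : realType} {m : nat} (r b : 'I_m -> R) (a s : R).
Let f := affine_map r b.
Let O := forward_orbit f a.
(* Only the points [f i a] can lie in [E0]. *)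
Let E0 := O `\` \bigcup_(i : 'I_m) (f i @` O).
Context (r_gt1 : forall i, 1 < `|r i|) (f_nondegenerate : ~ degenerate f)
  (s_def : \sum_(i < m) `|r i| `^ (- s) = 1)
  (O_non_overlapping : non_overlapping f O)
  (O_ulf : uniformly_locally_finite O).
Let p i := `|r i| `^ (- s).
Let lam i := ln `|r i|.

Lemma ratio_neq0 i : r i != 0.
Proof. by rewrite -normr_gt0 (lt_trans _ (r_gt1 i)). Qed.

Lemma ratio_norm_gt0 i : 0 < `|r i|.
Proof. by rewrite normr_gt0 ratio_neq0. Qed.

Lemma log_ratio_gt0 i : 0 < lam i.
Proof. by apply: ln_gt0. Qed.

Lemma expR_log_ratio i : expR (lam i) = `|r i|.
Proof. by rewrite /lam lnK // posrE ratio_norm_gt0. Qed.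

Lemma weightE i : p i = expR (- s * lam i).
Proof. by rewrite /p /powR gt_eqF ?ratio_norm_gt0. Qed.

Lemma weight_gt0 i : 0 < p i.
Proof. by rewrite weightE expR_gt0. Qed.

Lemma affine_inj i : injective (f i).
Proof.
by move=> x y; rewrite /f /affine_map => /addIr /(mulfI (ratio_neq0 i)).
Qed.

(** A single expanding affine map has a fixed point. *)
Lemma ifs_size_gt1 : (1 < m)%N.
Proof.
rewrite ltnNge; apply/negP => m1; apply: f_nondegenerate.
have [[i _]|m0] := pselect (exists i : 'I_m, True); last first.
  by exists 0 => i; exfalso; apply: m0; exists i.
have r1 : 1 - r i != 0.
  rewrite subr_eq0; apply/eqP => E; have := r_gt1 i.
  by rewrite -E normr1 ltxx.
exists (b i / (1 - r i)) => j.
have -> : j = i.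
  have lt1 (k : 'I_m) : k = 0%N :> nat.
    by have := leq_trans (ltn_ord k) m1; rewrite ltnS leqn0 => /eqP.
  by apply/val_inj; rewrite /= !lt1.
by rewrite /f /affine_map; field.
Qed.

(** With [s <= 0], each of the [m > 1] terms of the sum in [s_def] would be at
least [1]. *)
Lemma dimension_gt0 : 0 < s.
Proof.
rewrite ltNge; apply/negP => s0.
have : (m%:R : R) <= 1.
  have -> : m%:R = \sum_(i < m) 1 :> R by rewrite sumr_const card_ord.
  rewrite -[leRHS]s_def.
  apply: ler_sum => i _; rewrite -/(p i) weightE -expR0 ler_expR.
  by rewrite mulr_ge0 ?oppr_ge0 // ltW // log_ratio_gt0.
by rewrite lern1 leqNgt ifs_size_gt1.
Qed.

Lemma log_ratio_lower : exists2 l, 0 < l & forall i, l <= lam i.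
Proof.
pose S := \sum_(i < m) (lam i)^-1.
have lS i : (lam i)^-1 <= S.
  rewrite /S (bigD1 i) //= lerDl sumr_ge0 // => j _.
  by rewrite invr_ge0 ltW // log_ratio_gt0.
have S0 : 0 < S.
  apply: lt_le_trans (lS (Ordinal (ltnW ifs_size_gt1))).
  by rewrite invr_gt0 log_ratio_gt0.
exists S^-1; first by rewrite invr_gt0.
by move=> i; rewrite -[lam i]invrK lef_pV2 ?posrE ?invr_gt0 ?log_ratio_gt0.
Qed.

Lemma log_ratio_upper i : lam i <= \sum_(j < m) lam j.
Proof.
by rewrite (bigD1 i) //= lerDl sumr_ge0 // => j _; rewrite ltW // log_ratio_gt0.
Qed.

Lemma orbit_map i x : O x -> O (f i x).
Proof.
move=> [g Gg <-]; exists (f i \o g) => //.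
by apply: generated_comp => //; exact: generated_map.
Qed.

Lemma orbit_start i : O (f i a).
Proof. by exists (f i) => //; exact: generated_map. Qed.

Lemma orbit_inv y : O y -> (exists i x, O x /\ y = f i x) \/ exists i, y = f i a.
Proof.
move=> [g Gg <-].
suff : (exists i h, generated_semigroup f h /\ g = f i \o h) \/ exists i, g = f i.
  case=> [[i [h [Gh ->]]]|[i ->]]; last by right; exists i.
  by left; exists i, (h a); split=> //; exists h.
elim: Gg => [i|g' h _ + Gh _]; first by right; exists i.
case=> [[i [h' [Gh' ->]]]|[i ->]]; left; exists i.
  by exists (h' \o h); split => //; exact: generated_comp.
by exists h.
Qed.

Lemma orbit_remainder y : E0 y -> exists i, y = f i a.
Proof.
move=> [/orbit_inv[[i [x [Ox ->]]]|//]] [].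
by exists i => //; exists x.
Qed.

(** The self-similarity of the orbit: the images are pairwise disjoint, and each is
parametrized injectively by the orbit. *)
Lemma esum_orbit (u : R -> \bar R) : (forall y, 0 <= u y)%E ->
  \esum_(y in O) u y =
    (\sum_(i < m) \esum_(x in O) u (f i x) + \esum_(y in E0) u y)%E.
Proof.
move=> u0; rewrite (esumID (\bigcup_(i : 'I_m) (f i @` O))) //; congr (_ + _)%E.
rewrite (_ : O `&` _ = \bigcup_(i : 'I_m) (f i @` O)); last first.
  apply/setIidPr => y [i _ [x Ox <-]]; exact: orbit_map.
transitivity (\esum_(y in [set: R])
    \sum_(i < m) (if y \in f i @` O then u y else 0)%E).
  rewrite esum_mkcond; apply: eq_esum => y _.
  case: ifPn => [|yB].
    rewrite inE => -[i _ yi]; rewrite (bigD1 i) //= (mem_set yi) big1 ?adde0 //.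
    move=> j ji; case: ifPn => //; rewrite inE => yj.
    have := O_non_overlapping ji; rewrite -subset0 => /(_ y) []; split => //.
  rewrite big1 // => i _; case: ifPn => //; rewrite inE => yi.
  by case/negP: yB; rewrite inE; exists i.
rewrite esum_sum; last by move=> y i _ _; case: ifP.
apply: eq_bigr => i _; rewrite -esum_mkcond esum_image //.
by move=> x y _ _; exact: affine_inj.
Qed.

Lemma usum_orbit (u : R -> R) : (forall y, 0 <= u y) -> usummable O u ->
  [/\ forall i, usummable O (fun x => u (f i x)), usummable E0 u &
    usum O u = \sum_(i < m) usum O (fun x => u (f i x)) + usum E0 u].
Proof.
move=> u0 su; have := @esum_orbit (fun y => (u y)%:E) u0.
rewrite esum_usum // => E.
have e0 D (v : R -> R) : (forall y, 0 <= v y) -> (0 <= \esum_(y in D) (v y)%:E)%E.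
  by move=> v0; apply: esum_ge0 => y _; rewrite lee_fin.
have sE0 : usummable E0 u.
  rewrite usummable_lty //.
  apply: le_lt_trans (ltry (usum O u)); rewrite E leeDr //.
  by apply: sume_ge0 => i _; exact: e0.
have sf i : usummable O (fun x => u (f i x)).
  rewrite usummable_lty //.
  apply: le_lt_trans (ltry (usum O u)); rewrite E.
  rewrite (bigD1 i) //= -addeA leeDl // adde_ge0 ?e0 //.
  by apply: sume_ge0 => j _; exact: e0.
split=> //; apply: EFin_inj; rewrite E EFinD -sumEFin esum_usum //.
by congr (_ + _)%E; apply: eq_bigr => i _; rewrite esum_usum.
Qed.

Lemma usum_remainder (u : R -> R) (c : R) : (forall y, 0 <= u y <= c) ->
  usummable E0 u /\ usum E0 u <= m%:R * c.
Proof.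
move=> u01; have c0 : 0 <= c by have /andP[? ?] := u01 0; lra.
have u0 y : 0 <= u y by have /andP[] := u01 y.
have le : (\esum_(y in E0) (u y)%:E <= (m%:R * c)%:E)%E.
  apply: (@le_trans _ _ (\esum_(y in E0)
      \sum_(i < m) (if y \in [set f i a] then c%:E else 0)%E)).
    apply: le_esum => y /orbit_remainder[i ->].
    rewrite (bigD1 i) //= mem_set //; apply: (@le_trans _ _ c%:E).
      by rewrite lee_fin; have /andP[] := u01 (f i a).
    rewrite leeDl //; apply: sume_ge0 => j _.
    by case: ifP => // _; rewrite lee_fin.
  rewrite esum_sum; last by move=> y i _ _; case: ifP => // _; rewrite lee_fin.
  have -> : m%:R * c = \sum_(i < m) c by rewrite sumr_const card_ord mulr_natl.
  rewrite -sumEFin; apply: lee_sum => i _.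
  rewrite -esum_mkcondr esum_mkcondl esum_set1; first by case: ifP.
  by case: ifP.
have su : usummable E0 u by rewrite usummable_lty // (le_lt_trans le) ?ltry.
by split => //; rewrite -lee_fin -esum_usum.
Qed.

(** * The counting function and its bracket *)

(** The number of orbit points in [[-h, h]]. *)
Definition orbit_count (h : R) : R := usum O (fun y => (`|y| <= h)%R%:R).

Let N := orbit_count.

Lemma usummable_le h : usummable O (fun y => (`|y| <= h)%R%:R).
Proof.
have h1 : 0 < `|h| + 1 by rewrite ltr_wpDl.
have [C HC] := uniformly_locally_finite_usum O_ulf h1.
have [s0 _] := HC 0; apply: le_usummable s0 => y _.
rewrite ger0_norm ?ler0n // subr0 ler_nat.
have [yh|//] := leP `|y| h; rewrite (le_trans yh) //.
by have := ler_norm h; lra.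
Qed.

Lemma counting_orbit h :
  counting (O `&` `[- h, h]) = (N h)%:E :> \bar R.
Proof.
have E : O `&` `[- h, h] = O `&` [set y | `|y| <= h].
  by congr (_ `&` _); apply/seteqP; split=> y; rewrite /= in_itv /= ler_norml.
have h1 : 0 < `|h| + 1 by rewrite ltr_wpDl.
have := O_ulf h1; set S := ereal_sup _ => Soo.
rewrite E.
suff /counting_usum[] :
  (counting (O `&` [set y | (`|y| <= h)%R]) < (+oo : \bar R))%E by [].
rewrite -E; apply: le_lt_trans Soo.
apply: le_trans (ereal_sup_ubound _); last by exists 0.
have sub : O `&` `[- h, h] `<=` O `&` `[0 - (`|h| + 1), 0 + (`|h| + 1)].
  apply: setIS => y; rewrite /= !in_itv /= => /andP[y1 y2].
  have := ler_norm h; have := ler_norm (- h); rewrite normrN => ? ?.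
  by apply/andP; split; lra.
rewrite /counting; case: ifPn => /asboolP f1; case: ifPn => /asboolP f2.
- by rewrite lee_fin ler_nat; apply: finmap.fsubset_leq_card; rewrite -fset_set_sub.
- by rewrite leey.
- by exfalso; apply: f1; exact: sub_finite_set sub f2.
- by [].
Qed.

Lemma orbit_count_ge0 h : 0 <= N h.
Proof. by apply: usum_ge0 => y _; rewrite ler0n. Qed.

Lemma orbit_count_homo h h' : h <= h' -> N h <= N h'.
Proof.
move=> hh; apply: le_usum; [exact: usummable_le|exact: usummable_le|].
by move=> y _; rewrite ler_nat; case: (leP `|y| h) => // /le_trans ->.
Qed.

(* Chosen so that [f i] maps the ball of radius [h / |r i| - offset] into the ball
of radius [h - offset], and its preimage of the ball of radius [h + offset] lies
in the ball of radius [h / |r i| + offset]. *)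
Let offset := \sum_(i < m) `|b i| / (`|r i| - 1).

Lemma offset_ge0 : 0 <= offset.
Proof.
apply: sumr_ge0 => i _; rewrite divr_ge0 // subr_ge0; exact: ltW.
Qed.

Lemma offset_ge i : `|b i| + offset <= `|r i| * offset.
Proof.
have r10 : 0 < `|r i| - 1 by rewrite subr_gt0.
suff : `|b i| / (`|r i| - 1) <= offset.
  by rewrite ler_pdivrMr //; lra.
rewrite /offset (bigD1 i) //= lerDl sumr_ge0 // => j _.
by rewrite divr_ge0 // subr_ge0; exact: ltW.
Qed.

(** The constant [2] absorbs the at most [m] points of the orbit outside its images,
as [2 + m <= 2 * m]. *)
Lemma orbit_count_sub h :
  N (h + offset) + 2 <= \sum_(i < m) (N (h / `|r i| + offset) + 2).
Proof.
pose u (y : R) : R := (`|y| <= h + offset)%R%:R.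
have u01 y : 0 <= u y <= 1 by rewrite /u ler0n lern1 leq_b1.
have u0 y : 0 <= u y by have /andP[] := u01 y.
have [sf sE NE] := usum_orbit u0 (usummable_le (h + offset)).
rewrite [N (h + offset)]NE.
have [_ uE] := usum_remainder u01.
rewrite big_split /= sumr_const card_ord -[2 *+ m]mulr_natr.
have m2 : 2 <= m%:R :> R by rewrite ler_nat ifs_size_gt1.
suff : \sum_(i < m) usum O (fun x => u (f i x)) <=
    \sum_(i < m) N (h / `|r i| + offset) by lra.
apply: ler_sum => i _; apply: le_usum => // [|x _]; first exact: usummable_le.
rewrite ler_nat /f /affine_map; case: (leP `|r i * x + b i|) => // le1.
have : `|r i * x| - `|b i| <= `|r i * x + b i|.
  by have := ler_normB (r i * x + b i) (b i); rewrite addrK; lra.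
have ri := ratio_norm_gt0 i; rewrite normrM => h1.
have -> // : `|x| <= h / `|r i| + offset.
rewrite -(ler_pM2l ri) mulrDr mulrCA divff ?mulr1 ?lt0r_neq0 //.
by have := offset_ge i; lra.
Qed.

Lemma orbit_count_super h :
  \sum_(i < m) N (h / `|r i| - offset) <= N (h - offset).
Proof.
pose u (y : R) : R := (`|y| <= h - offset)%R%:R.
have u0 y : 0 <= u y by rewrite ler0n.
have [sf sE NE] := usum_orbit u0 (usummable_le (h - offset)).
rewrite [N (h - offset)]NE.
have uE : 0 <= usum E0 u by exact: usum_ge0.
suff : \sum_(i < m) N (h / `|r i| - offset) <=
    \sum_(i < m) usum O (fun x => u (f i x)) by lra.
apply: ler_sum => i _; apply: le_usum => // [|x _]; first exact: usummable_le.
rewrite ler_nat /f /affine_map; case: (leP `|x|) => // le1.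
have : `|r i * x + b i| <= `|r i * x| + `|b i| := ler_normD _ _.
have ri := ratio_norm_gt0 i; rewrite normrM => h1.
have -> // : `|r i * x + b i| <= h - offset.
move: le1; rewrite -(ler_pM2l ri) mulrBr mulrCA divff ?mulr1 ?lt0r_neq0 //.
by have := offset_ge i; lra.
Qed.

Lemma orbit_count_offset : exists2 C, 0 <= C & forall h,
  N (h + offset) - N (h - offset) <= C.
Proof.
have D1 : 0 < offset + 1 by rewrite ltr_wpDl // offset_ge0.
have [C HC] := uniformly_locally_finite_usum O_ulf D1.
have C0 : 0 <= C.
  by have [_] := HC 0; apply: le_trans; apply: usum_ge0 => y _; rewrite ler0n.
exists (C + C) => [|h]; first by rewrite addr_ge0.
have [s1 c1] := HC h; have [s2 c2] := HC (- h).
apply: le_trans (lerD c1 c2); rewrite -usumD // -usumB; try exact: usummable_le.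
apply: le_usum; [apply: usummableB; exact: usummable_le|exact: usummableD|].
move=> y _; set A := (`|y| <= h + offset)%R; set B := (`|y| <= h - offset)%R.
set P := (`|y - h| <= _)%R; set Q := (`|y - - h| <= _)%R.
have : A -> B || (P || Q).
  rewrite /A /B /P /Q opprK => yh; have [//|yh'] := leP `|y| (h - offset) => /=.
  have [y0|y0] := leP 0 y.
    rewrite (ger0_norm y0) in yh yh'; apply/orP; left.
    by rewrite ler_norml; apply/andP; split; lra.
  rewrite (ltr0_norm y0) in yh yh'; apply/orP; right.
  by rewrite ler_norml; apply/andP; split; lra.
case: A; case: B; case: P; case: Q => //=; lra.
Qed.

(** The ratio [N h / h `^ s] at [h = expR t]. *)
Definition normalized_count (t : R) : R := N (expR t) * expR (- (s * t)).

Let Z := normalized_count.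

Let X t := (N (expR t + offset) + 2) * expR (- (s * t)).
Let Y t := N (expR t - offset) * expR (- (s * t)).

Lemma scaling_shift i t : expR (- (s * t)) = p i * expR (- (s * (t - lam i))).
Proof. by rewrite weightE -expRD; congr expR; ring. Qed.

Lemma expR_shift i t : expR (t - lam i) = expR t / `|r i|.
Proof. by rewrite expRD expRN expR_log_ratio. Qed.

Lemma normalized_count_bracketing t : Y t <= Z t <= X t.
Proof.
have e0 := expR_gt0 (- (s * t)); have D0 := offset_ge0.
rewrite /Y /Z /X /normalized_count !ler_pM2r //; apply/andP; split.
  by apply: orbit_count_homo; lra.
have : N (expR t) <= N (expR t + offset) by apply: orbit_count_homo; lra.
by lra.
Qed.

Lemma normalized_count_ge0 t : 0 <= Z t.
Proof. by rewrite mulr_ge0 // ?orbit_count_ge0 // expR_ge0. Qed.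

(** The counting function is nondecreasing. *)
Lemma normalized_count_slow t u : 0 <= u -> expR (- (s * u)) * Z t <= Z (t + u).
Proof.
move=> u0; rewrite /Z /normalized_count mulrCA -expRD.
have -> : - (s * u) + - (s * t) = - (s * (t + u)) by ring.
rewrite ler_pM2r ?expR_gt0 //; apply: orbit_count_homo.
by rewrite ler_expR; lra.
Qed.

Lemma subrenewal_upper : subrenewal p lam X.
Proof.
move=> t; rewrite /X; apply: (@le_trans _ _
  ((\sum_(i < m) (N (expR t / `|r i| + offset) + 2)) * expR (- (s * t)))).
  by rewrite ler_pM2r ?expR_gt0 //; exact: orbit_count_sub.
rewrite mulr_suml; apply: ler_sum => i _.
by rewrite expR_shift mulrCA -scaling_shift.
Qed.

Lemma subrenewal_lower : subrenewal p lam (fun t => - Y t).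
Proof.
move=> t; rewrite /Y; under eq_bigr do rewrite mulrN.
rewrite sumrN lerN2; apply: (@le_trans _ _
  ((\sum_(i < m) N (expR t / `|r i| - offset)) * expR (- (s * t)))).
  rewrite mulr_suml; apply: ler_sum => i _.
  by rewrite expR_shift mulrCA -scaling_shift.
by rewrite ler_pM2r ?expR_gt0 //; exact: orbit_count_super.
Qed.

Lemma expR_small (C e : R) : 0 <= C -> 0 < e ->
  exists T : R, forall t, T <= t -> C * expR (- (s * t)) <= e.
Proof.
move=> C0 e0; have s0 := dimension_gt0.
exists (C / (e * s)) => t tT.
have t0 : 0 <= t by apply: le_trans tT; rewrite divr_ge0 ?mulr_ge0 // ltW.
rewrite expRN ler_pdivrMr ?expR_gt0 //.
have h1 : 1 + s * t <= expR (s * t) := expR_ge1Dx _.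
have es : 0 < e * s by rewrite mulr_gt0.
move: tT; rewrite ler_pdivrMr // => tT.
have : e * (1 + s * t) <= e * expR (s * t) by rewrite ler_pM2l.
by lra.
Qed.

Lemma orbit_bracket : exists M, renewal_bracket p lam X Y 0 M.
Proof.
have [l l0 lle] := log_ratio_lower.
pose L := \sum_(j < m) lam j.
pose M := N (expR L + offset) + 2.
have M0 : 0 <= M by rewrite addr_ge0 ?orbit_count_ge0.
have L0 : 0 <= L by apply: sumr_ge0 => i _; rewrite ltW // log_ratio_gt0.
have s0 := dimension_gt0.
have XM t : 0 <= t -> X t <= M.
  move=> t0.
  apply: (subrenewal_window (T := L) (Q := setT) weight_gt0 s_def l0 lle log_ratio_upper
    subrenewal_upper) => //.
  - rewrite subrr => u _ u0 uL; rewrite /X.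
    have e1 : expR (- (s * u)) <= 1.
      by rewrite -expR0 ler_expR oppr_le0 mulr_ge0 // ltW.
    have h1 : N (expR u + offset) <= N (expR L + offset).
      by apply: orbit_count_homo; rewrite lerD2r ler_expR.
    have h0 : 0 <= N (expR u + offset) := orbit_count_ge0 _.
    have := expR_ge0 (- (s * u)); rewrite /M => e0.
    by rewrite -[leRHS]mulr1; apply: ler_pM; lra.
  - by rewrite subrr.
exists M; split.
- exact: subrenewal_upper.
- exact: subrenewal_lower.
- by move=> t; have /andP[h1 h2] := normalized_count_bracketing t; lra.
- move=> t t0; split; first exact: XM.
  have : 0 <= Y t by rewrite mulr_ge0 ?orbit_count_ge0 ?expR_ge0.
  by lra.
- move=> e e0; have [C C0 HC] := orbit_count_offset.
  have C20 : 0 <= C + 2 by lra.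
  have [T HT] := expR_small C20 e0.
  exists T => t /HT; apply: le_trans; rewrite /X /Y -mulrBl.
  by rewrite ler_pM2r ?expR_gt0 //; have := HC (expR t); lra.
Qed.

(** The counting function is at least [1] at large times, so that the supersolution
[Y] is bounded below on one window, hence from then on. *)
Lemma normalized_count_lower : exists2 c : R, 0 < c & exists t0 : R,
  forall t, t0 <= t -> c <= Z t.
Proof.
have [l l0 lle] := log_ratio_lower.
pose L := \sum_(j < m) lam j.
have s0 := dimension_gt0.
pose y := f (Ordinal (ltnW ifs_size_gt1)) a.
have Oy : O y := orbit_start _.
pose t1 := `|y| + offset.
have N1 h : `|y| <= h -> 1 <= N h.
  move=> yh; have := @sum_fset_le_usum _ O [set y]
    (fun x => (`|x| <= h)%R%:R : R) (finite_set1 y).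
  rewrite fsbig_set1 yh; apply=> //.
  - by move=> _ ->.
  - exact: usummable_le.
exists (expR (- (s * (t1 + L)))); first exact: expR_gt0.
exists t1 => t t1t.
suff : - Y t <= - expR (- (s * (t1 + L))).
  by have /andP[h1 h2] := normalized_count_bracketing t; lra.
apply: (subrenewal_window (T := t1 + L) (Q := setT) weight_gt0 s_def l0 lle
  log_ratio_upper subrenewal_lower) => //.
- rewrite addrK => u _ u1 u2; rewrite lerN2 /Y.
  have h1 : 1 <= N (expR u - offset).
    apply: N1; have := expR_ge1Dx u; rewrite /t1 in u1; lra.
  have h2 : expR (- (s * (t1 + L))) <= expR (- (s * u)).
    by rewrite ler_expR lerN2 ler_pM2l.
  rewrite -[leLHS]mul1r; apply: ler_pM => //; exact: expR_ge0.
- by rewrite addrK.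
Qed.

Lemma normalized_count_upper : exists M : R, forall t : R, 0 <= t -> Z t <= M.
Proof.
have [M [_ _ _ XM _]] := orbit_bracket.
exists M => t /XM[h _]; have /andP[_ h2] := normalized_count_bracketing t; lra.
Qed.

(** * Truncated sums over the orbit *)

(* [min1_powRN s] as a function of the absolute value, extended by [1]. *)
Let profile (z : R) : R := if z <= 1 then 1 else z `^ (- s).

Lemma min1_powRNE y : min1_powRN s y = profile `|y|.
Proof.
have s0 := dimension_gt0; rewrite /min1_powRN /profile.
case: eqP => [->|/eqP y0]; first by rewrite normr0 ler01.
have ay : 0 < `|y| by rewrite normr_gt0.
case: leP => y1.
  rewrite min_l // /powR gt_eqF // -expR0 ler_expR; apply: mulr_le0.
    by rewrite oppr_le0 ltW.
  exact: ln_le0.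
rewrite min_r // /powR gt_eqF // -expR0 ler_expR mulNr oppr_le0 mulr_ge0 ?ltW //.
exact: ln_gt0.
Qed.

Lemma profile_gt1 z : 1 < z -> profile z = expR (- (s * ln z)).
Proof.
move=> z1; rewrite /profile leNgt z1 /= /powR gt_eqF ?(lt_trans _ z1) //.
by congr expR; ring.
Qed.

Lemma profile_range z : 0 <= profile z <= 1.
Proof.
have s0 := dimension_gt0.
have [z1|z1] := leP z 1; first by rewrite /profile z1 lexx ler01.
rewrite profile_gt1 // expR_ge0 -expR0 ler_expR oppr_le0 mulr_ge0 ?ltW //.
exact: ln_gt0.
Qed.

Lemma profile_homo : {homo profile : x y / x <= y >-> y <= x}.
Proof.
move=> x y xy; have s0 := dimension_gt0.
have [x1|x1] := leP x 1; first by rewrite {2}/profile x1; have /andP[] := profile_range y.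
have y1 := lt_le_trans x1 xy.
rewrite !profile_gt1 // ler_expR lerN2 ler_pM2l //.
by rewrite ler_ln // posrE (lt_trans ltr01).
Qed.

Let g := min1_powRN s.

Lemma min1_powRN_range y : 0 <= g y <= 1.
Proof. by rewrite /g min1_powRNE profile_range. Qed.

Lemma min1_powRN_eq1 y : `|y| <= 1 -> g y = 1.
Proof. by move=> y1; rewrite /g min1_powRNE /profile y1. Qed.

Lemma min1_powRN_scale i x : 1 <= `|x| -> g (r i * x) = p i * g x.
Proof.
move=> x1; have ri := r_gt1 i; rewrite /g !min1_powRNE normrM.
have x0 : 0 < `|x| := lt_le_trans ltr01 x1.
have rx1 : 1 < `|r i| * `|x| by nra.
rewrite profile_gt1 // lnM ?posrE ?ratio_norm_gt0 // -/(lam i).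
rewrite mulrDr opprD expRD weightE mulNr.
congr (_ * _); have [x1'|x1'] := leP `|x| 1; last by rewrite profile_gt1.
by rewrite /profile x1' (@le_anti _ _ `|x| 1) ?x1 ?x1' // ln1 mulr0 oppr0 expR0.
Qed.

(* For [t > 0], [cut t] is positive exactly at the points [y] with
[|y| < expR t]. *)
Let level t := expR (- (s * t)).
Let cut t y := Num.max (g y - level t) 0.

Lemma cut_ge0 t y : 0 <= cut t y.
Proof. by rewrite le_max lexx orbT. Qed.

Lemma min1_powRN_ge_level t y : 0 <= t -> `|y| <= expR t -> level t <= g y.
Proof.
move=> t0 yt; rewrite /g min1_powRNE; have s0 := dimension_gt0.
have [y1|y1] := leP `|y| 1.
  by rewrite /profile y1 /level -expR0 ler_expR oppr_le0 mulr_ge0 // ltW.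
rewrite profile_gt1 // ler_expR lerN2 ler_pM2l // -[t]expRK ler_ln // posrE ?expR_gt0 //.
exact: lt_trans ltr01 y1.
Qed.

Lemma min1_powRN_le_level t y : expR t < `|y| -> g y <= level t.
Proof.
move=> ty; rewrite /g min1_powRNE; have s0 := dimension_gt0.
have [t0|t0] := leP 0 t.
  have y1 : 1 < `|y| by apply: le_lt_trans ty; rewrite -expR0 ler_expR.
  rewrite profile_gt1 // ler_expR lerN2 ler_pM2l // -[leLHS]expRK.
  rewrite ler_ln ?posrE ?expR_gt0 //.
    exact: ltW.
  exact: lt_trans (expR_gt0 t) ty.
have /andP[_ g1] := profile_range `|y|; apply: (le_trans g1).
by rewrite /level -expR0 ler_expR oppr_ge0 mulr_ge0_le0 // ltW.
Qed.

Lemma cut_le t y : cut t y <= (`|y| <= expR t)%R%:R.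
Proof.
have [yt|yt] := leP `|y| (expR t).
  rewrite /cut /= mulr1n ge_max ler01 andbT.
  have /andP[_ ?] := min1_powRN_range y; have := expR_ge0 (- (s * t)).
  by rewrite /level; lra.
by rewrite /cut max_r // subr_le0 min1_powRN_le_level.
Qed.

Lemma usummable_cut t : usummable O (cut t).
Proof.
apply: le_usummable (usummable_le (expR t)) => y _.
by rewrite ger0_norm ?cut_ge0 // cut_le.
Qed.

Let A t := usum O (cut t).

Lemma cut_increment t t' y : 0 <= t -> t <= t' ->
  (level t - level t') * (`|y| <= expR t)%R%:R <= cut t' y - cut t y
    <= (level t - level t') * (`|y| <= expR t')%R%:R.
Proof.
move=> t0 tt'; have s0 := dimension_gt0.
have et : level t' <= level t by rewrite ler_expR lerN2 ler_pM2l.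
have tt := tt'; rewrite -ler_expR in tt.
have [yt|yt] := leP `|y| (expR t).
  have yt' := le_trans yt tt; rewrite yt' !mulr1.
  have h1 := min1_powRN_ge_level t0 yt.
  have h2 := min1_powRN_ge_level (le_trans t0 tt') yt'.
  by rewrite /cut !max_l ?subr_ge0 //; apply/andP; split; lra.
rewrite mulr0.
have h1 := min1_powRN_le_level yt.
have -> : cut t y = 0 by rewrite /cut max_r // subr_le0.
rewrite subr0 cut_ge0 /=.
have [yt'|yt'] := leP `|y| (expR t').
  by rewrite mulr1 /cut ge_max; apply/andP; split; lra.
by rewrite mulr0 /cut ge_max lexx andbT subr_le0 min1_powRN_le_level.
Qed.

(** An integrated form of the statement that the derivative of [A] is [s * Z]. *)
Lemma cut_sum_increment t t' : 0 <= t -> t <= t' ->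
  Z t * (1 - expR (- (s * (t' - t)))) <= A t' - A t
    <= Z t' * (expR (s * (t' - t)) - 1).
Proof.
move=> t0 tt'; have s0 := dimension_gt0.
have et : 0 <= level t - level t' by rewrite subr_ge0 ler_expR lerN2 ler_pM2l.
have NE h : (level t - level t') * N h =
    usum O (fun y => (level t - level t') * (`|y| <= h)%R%:R).
  by rewrite usumZ // => y _; rewrite ler0n.
have sE h : usummable O (fun y => (level t - level t') * (`|y| <= h)%R%:R).
  by apply: usummableZ; exact: usummable_le.
have E1 : Z t * (1 - expR (- (s * (t' - t)))) = (level t - level t') * N (expR t).
  rewrite /Z /normalized_count /level.
  have -> : - (s * t') = - (s * t) + - (s * (t' - t)) by ring.
  by rewrite expRD; ring.
have E2 : Z t' * (expR (s * (t' - t)) - 1) = (level t - level t') * N (expR t').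
  rewrite /Z /normalized_count /level.
  have -> : - (s * t) = - (s * t') + s * (t' - t) by ring.
  by rewrite expRD; ring.
have s1 := usummable_cut t; have s2 := usummable_cut t'.
rewrite E1 E2 !NE -usumB //; apply/andP; split; apply: le_usum => //;
  try exact: usummableB; by move=> y _; have /andP[] := cut_increment y t0 tt'.
Qed.

Let term1 (x : R) : R := \sum_(i < m) g (r i * x) - 1.
Let term2 (x : R) : R := \sum_(i < m) (g (r i * x + b i) - g (r i * x)).
Let unit_ball : set R := (`]-1, 1[)%classic.

(* The bracket in the formula for the density. *)
Let V := usum (O `&` unit_ball) term1 + usum O term2 + usum E0 g.

(** The variation estimate for the function [min1_powRN s] truncated at the height
[level t]. *)
Lemma variation_truncated i : exists2 C, 0 <= C &
  forall t, usummable O (fun x => Num.min (g (r i * x + b i)) (level t)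
                                - Num.min (g (r i * x)) (level t)) /\
    usum O (fun x => `|Num.min (g (r i * x + b i)) (level t)
                      - Num.min (g (r i * x)) (level t)|) <= C * level t.
Proof.
have [C C0 H] := variation_usum (b i) O_ulf (r_gt1 i).
exists C => // t; have [] := H (fun z => Num.min (profile z) (level t)) (level t).
- by move=> x y xy; rewrite le_min !ge_min lexx profile_homo // orbT.
- move=> x; rewrite le_min ge_min lexx orbT andbT expR_ge0 andbT.
  by have /andP[] := profile_range x.
move=> h1 h2; split; rewrite /g.
  by apply: eq_usummable h1 => x _; rewrite !min1_powRNE.
apply: le_trans h2; rewrite le_eqVlt; apply/orP; left; apply/eqP.
by apply: eq_usum => x _; rewrite !min1_powRNE.
Qed.

(** At [t = 0] the level is [1] and the truncation has no effect. *)
Lemma usummable_term i :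
  usummable O (fun x => g (r i * x + b i) - g (r i * x)).
Proof.
have [C _ H] := variation_truncated i; have [h _] := H 0.
apply: eq_usummable h => x _; rewrite /level mulr0 oppr0 expR0.
have /andP[_ h1] := min1_powRN_range (r i * x + b i).
by have /andP[_ h2] := min1_powRN_range (r i * x); rewrite !min_l.
Qed.

Lemma usummable_term2 : usummable O term2.
Proof. by apply: usummable_sum => i; exact: usummable_term. Qed.

Lemma defect_small i x : `|g (r i * x) - p i * g x| <= (`|x| <= 1)%R%:R.
Proof.
have [x1|x1] := leP `|x| 1; last by rewrite min1_powRN_scale ?(ltW x1) // subrr normr0.
have /andP[h1 h2] := min1_powRN_range (r i * x).
have p0 := weight_gt0 i; have p1 : p i <= 1.
  have s0 := dimension_gt0.
  by rewrite weightE -expR0 ler_expR mulNr oppr_le0 mulr_ge0 ?ltW // log_ratio_gt0.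
by rewrite (min1_powRN_eq1 x1) /= mulr1 mulr1n ler_norml; apply/andP; split; lra.
Qed.

Lemma usummable_defect i : usummable O (fun x => g (r i * x) - p i * g x).
Proof. by apply: le_usummable (usummable_le 1) => x _; exact: defect_small. Qed.

(** The functions [g (r i * x)] and [p i * g x] agree outside the open unit ball,
and inside it [g x = 1], while the weights have sum [1]. *)
Lemma term1_defect x : (if x \in unit_ball then term1 x else 0) =
  \sum_(i < m) (g (r i * x) - p i * g x).
Proof.
rewrite sumrB -mulr_suml s_def mul1r.
case: ifPn => [|/negP xI].
  rewrite inE /unit_ball /= in_itv /= => /andP[x1 x2].
  rewrite (@min1_powRN_eq1 x) // ler_norml; apply/andP; split; exact: ltW.
have x1 : 1 <= `|x|.
  rewrite leNgt; apply/negP => x1; apply: xI; rewrite inE /unit_ball /= in_itv /=.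
  by rewrite -ltr_norml.
under eq_bigr do rewrite min1_powRN_scale //.
by rewrite -mulr_suml s_def mul1r subrr.
Qed.

Let I t := A t - \sum_(i < m) p i * A (t - lam i).

(** Writing [max (z - e) 0 = z - min z e] and applying the orbit decomposition to
[A t], the terms of [V - I t] become differences of functions truncated at the
height [level t], to which the variation estimate applies. *)
Lemma density_defect : exists2 C, 0 <= C & forall t, `|V - I t| <= C * level t.
Proof.
have [Cv Cv0 HC] : exists2 C : 'I_m -> R, forall i, 0 <= C i & forall i t,
    usum O (fun x => `|Num.min (g (r i * x + b i)) (level t)
                      - Num.min (g (r i * x)) (level t)|) <= C i * level t.
  have /choice[C HC] : forall i, exists C, 0 <= C /\ forall t,
      usum O (fun x => `|Num.min (g (r i * x + b i)) (level t)
                        - Num.min (g (r i * x)) (level t)|) <= C * level t.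
    move=> i; have [C C0 H] := variation_truncated i.
    by exists C; split=> // t; have [] := H t.
  by exists C => i; have [] := HC i.
exists (\sum_(i < m) (Cv i + N 1) + m%:R).
  by rewrite addr_ge0 // sumr_ge0 // => i _; rewrite addr_ge0 // orbit_count_ge0.
move=> t.
have e0 : 0 < level t := expR_gt0 _.
pose T i x := (g (r i * x) - p i * g x) + (g (r i * x + b i) - g (r i * x)).
have sT i : usummable O (T i).
  by apply: usummableD; [exact: usummable_defect|exact: usummable_term].
have VE : V = \sum_(i < m) usum O (T i) + usum E0 g.
  rewrite /V; congr (_ + _); rewrite usum_setI.
  have -> : usum O (fun x => if x \in unit_ball then term1 x else 0) =
      usum O (fun x => \sum_(i < m) (g (r i * x) - p i * g x)).
    by apply: eq_usum => x _; rewrite term1_defect.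
  rewrite (usum_sum _ usummable_defect) (usum_sum _ usummable_term).
  rewrite -big_split /=; apply: eq_bigr => i _.
  by rewrite (usumD (usummable_defect i) (usummable_term i)).
have [sf sE AE] := usum_orbit (cut_ge0 t) (usummable_cut t).
(* [k i] is the summand of [p i * A (t - lam i)]. *)
pose k i x := Num.max (p i * g x - level t) 0.
have kE i x : k i x = p i * cut (t - lam i) x.
  rewrite /k /cut maxr_pMr ?ltW ?weight_gt0 // mulr0 mulrBr -scaling_shift.
  by [].
have sk i : usummable O (k i).
  apply: le_usummable (usummable_cut (t - lam i)) => x _.
  rewrite kE normrM (gtr0_norm (weight_gt0 i)) (ger0_norm (cut_ge0 _ _)).
  rewrite -[leRHS]mul1r; apply: ler_wpM2r; first exact: cut_ge0.
  have s0 := dimension_gt0.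
  by rewrite weightE -expR0 ler_expR mulNr oppr_le0 mulr_ge0 ?ltW // log_ratio_gt0.
have kA i : p i * A (t - lam i) = usum O (k i).
  rewrite -usumZ; last 2 first.
  - exact: ltW (weight_gt0 i).
  - by move=> x _; exact: cut_ge0.
  by apply: eq_usum => x _; rewrite kE.
pose W i x := Num.min (g (r i * x + b i)) (level t) - Num.min (p i * g x) (level t).
have cutE (z : R) : Num.max (z - level t) 0 = z - Num.min z (level t).
  have [h|h] := leP z (level t).
    by rewrite max_r ?subrr // subr_le0.
  by rewrite max_l // subr_ge0 ltW.
have WE i x : W i x = T i x - cut t (f i x) + k i x.
  by rewrite /W /T /k /cut !cutE /f /affine_map; ring.
have sW i : usummable O (W i).
  apply: (@eq_usummable _ O (W i) (fun x => T i x - cut t (f i x) + k i x)) => [x _|].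
    exact: WE.
  exact: (usummableD (usummableB (sT i) (sf i)) (sk i)).
have [sg _] := usum_remainder min1_powRN_range.
have DE : V - I t = \sum_(i < m) usum O (W i) + usum E0 (fun x => g x - cut t x).
  have WS : \sum_(i < m) usum O (W i) = \sum_(i < m) usum O (T i)
      - \sum_(i < m) usum O (fun x => cut t (f i x)) + \sum_(i < m) usum O (k i).
    rewrite -sumrB -big_split; apply: eq_bigr => i _ /=.
    rewrite -(usumB (sT i) (sf i)) -(usumD (usummableB (sT i) (sf i)) (sk i)).
    by apply: eq_usum => x _; rewrite WE.
  rewrite usumB // VE /I WS [A t]AE (eq_bigr _ (fun i _ => kA i)).
  by ring.
have Wle i : `|usum O (W i)| <= (Cv i + N 1) * level t.
  apply: (le_trans (ler_norm_usum (sW i))); rewrite mulrDl.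
  have s1 : usummable O (fun x => level t * (`|x| <= 1)%R%:R).
    by apply: usummableZ; exact: usummable_le.
  have [C _ /(_ t)[s2 _]] := variation_truncated i.
  apply: (@le_trans _ _ (usum O (fun x => `|Num.min (g (r i * x + b i)) (level t)
                      - Num.min (g (r i * x)) (level t)| + level t * (`|x| <= 1)%R%:R))).
    apply: le_usum => [||x _].
    - exact: usummable_abs.
    - by apply: usummableD => //; exact: usummable_abs.
    rewrite /W; have [x1|x1] := leP `|x| 1; last first.
      by rewrite mulr0 addr0 min1_powRN_scale // (ltW x1).
    rewrite mulr1.
    apply: (le_trans (ler_distD (Num.min (g (r i * x)) (level t)) _ _)).
    rewrite lerD2l.
    have m01 z : 0 <= z -> 0 <= Num.min z (level t) <= level t.
      by move=> z0; rewrite le_min z0 ltW //= ge_min lexx orbT.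
    have /andP[a1 a2] := m01 (g (r i * x)) (proj1 (andP (min1_powRN_range _))).
    have /andP[a3 a4] := m01 (p i * g x)
      (mulr_ge0 (ltW (weight_gt0 i)) (proj1 (andP (min1_powRN_range _)))).
    by rewrite ler_norml; apply/andP; split; lra.
  rewrite usumD //; last exact: usummable_abs.
  apply: lerD; first exact: HC.
  rewrite (usumZ (ltW e0)); last by move=> x _; rewrite ler0n.
  by rewrite mulrC.
have Ele : `|usum E0 (fun x => g x - cut t x)| <= m%:R * level t.
  have rng y : 0 <= g y - cut t y <= level t.
    have -> : g y - cut t y = Num.min (g y) (level t) by rewrite /cut cutE; ring.
    rewrite le_min ge_min lexx orbT (ltW e0) !andbT.
    by have /andP[] := min1_powRN_range y.
  have [_ h] := usum_remainder rng.
  rewrite ger0_norm //; apply: usum_ge0 => y _.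
  by have /andP[] := rng y.
rewrite DE mulrDl; apply: (le_trans (ler_normD _ _)); apply: lerD => //.
rewrite mulr_suml; apply: (le_trans (ler_norm_sum _ _ _)).
by apply: ler_sum => i _; exact: Wle.
Qed.

(** * Convergence of the normalized count and the density *)

Lemma normalized_count_period i : asymptotic_period Z (lam i).
Proof.
have [l l0 lle] := log_ratio_lower; have [M br] := orbit_bracket.
exact: (bracket_period weight_gt0 s_def l0 lle log_ratio_upper i br
  normalized_count_bracketing).
Qed.

Lemma normalized_count_cauchy i j : irrational (lam i / lam j) ->
  forall e : R, 0 < e -> exists T : R, forall t, T <= t -> forall t', t <= t' ->
    `|Z t' - Z t| <= e.
Proof.
move=> irr; have [l l0 lle] := log_ratio_lower; have [M br] := orbit_bracket.
apply: (renewal_nonarithmetic weight_gt0 s_def l0 lle log_ratio_upper br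
  normalized_count_bracketing dimension_gt0 normalized_count_ge0
  normalized_count_slow).
move=> d d0.
apply: (asymptotic_period_small (log_ratio_gt0 i) (log_ratio_gt0 j) irr) => //;
  exact: normalized_count_period.
Qed.

Lemma normalized_count_cauchy_coset (rho : R) (k : 'I_m -> nat) :
  arithmetic_base r rho k ->
  forall e : R, 0 < e -> exists T : R, forall t, T <= t -> forall n,
    `|Z (t + n%:R * ln rho) - Z t| <= e.
Proof.
case=> rho1 k0 gk rk; have [l l0 lle] := log_ratio_lower; have [M br] := orbit_bracket.
have lamk i : lam i = (k i)%:R * ln rho.
  by rewrite /lam rk lnXn ?mulr_natl // (lt_trans ltr01).
apply: (renewal_arithmetic weight_gt0 s_def l0 lle log_ratio_upper br
  normalized_count_bracketing _ lamk); first exact: ln_gt0.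
rewrite -[ln rho]mul1r -[1](mulr1n 1) -gk.
by apply: asymptotic_period_biggcdn => i; rewrite -lamk; exact: normalized_count_period.
Qed.

(** If [Z] stays within [e] of [c], then [A] grows with slope within [s * e] of
[s * c]. *)
Lemma cut_sum_slope (c e T : R) : 0 <= T ->
  (forall t, T <= t -> c - e <= Z t <= c + e) ->
  forall t t', T <= t -> t <= t' ->
    (c - e) * (s * (t' - t)) <= A t' - A t <= (c + e) * (s * (t' - t)).
Proof.
move=> T0 HZ t t' Tt tt'; have s0 := dimension_gt0.
have sd d : 0 <= d -> 0 <= s * d by move=> d0; rewrite mulr_ge0 // ltW.
have d00 : 0 < (2 * s)^-1 by rewrite invr_gt0 mulr_gt0.
apply/andP; split.
- have K0 : 0 <= `|c - e| * s ^+ 2 by rewrite mulr_ge0 // sqr_ge0.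
  suff : (c - e) * (s * t') - A t' <= (c - e) * (s * t) - A t by lra.
  apply: (nonincreasing_of_quadratic_increments
    (F := fun u => (c - e) * (s * u) - A u) K0 d00) Tt tt' => u d Tu /andP[d0 _].
  have ud : u <= u + d by lra.
  have /andP[h _] := cut_sum_increment (le_trans T0 Tu) ud.
  have /andP[h1 _] := HZ u Tu.
  move: h; have -> : u + d - u = d by ring.
  set x := s * d => h; have x0 : 0 <= x := sd _ d0.
  have h2 := expR_ge1Dx (- x); have h3 := expRN_le_quadratic x0.
  have h4 : expR (- x) <= 1 by rewrite -expR0 ler_expR; lra.
  have h5 : (c - e) * (1 - expR (- x)) <= Z u * (1 - expR (- x)).
    by apply: ler_wpM2r => //; lra.
  have h6 : (c - e) * (x - (1 - expR (- x))) <= `|c - e| * x ^+ 2.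
    apply: (@le_trans _ _ (`|c - e| * (x - (1 - expR (- x))))).
      by apply: ler_wpM2r; [lra|exact: ler_norm].
    by apply: ler_wpM2l => //; lra.
  have -> : `|c - e| * s ^+ 2 * d ^+ 2 = `|c - e| * x ^+ 2 by rewrite /x; ring.
  have -> : (c - e) * (s * (u + d)) = (c - e) * (s * u) + (c - e) * x.
    by rewrite /x; ring.
  by lra.
- have K0 : 0 <= `|c + e| * (2 * s ^+ 2) by rewrite mulr_ge0 // mulr_ge0 // sqr_ge0.
  suff : A t' - (c + e) * (s * t') <= A t - (c + e) * (s * t) by lra.
  apply: (nonincreasing_of_quadratic_increments
    (F := fun u => A u - (c + e) * (s * u)) K0 d00) Tt tt' => u d Tu /andP[d0 dd].
  have ud : u <= u + d by lra.
  have /andP[_ h] := cut_sum_increment (le_trans T0 Tu) ud.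
  have /andP[_ h1] := HZ (u + d) (le_trans Tu ud).
  move: h; have -> : u + d - u = d by ring.
  set x := s * d => h; have x0 : 0 <= x := sd _ d0.
  have x2 : x <= 2^-1.
    move: dd; rewrite invfM -ler_pdivrMr ?invr_gt0 // invrK mulrC => dd.
    by rewrite /x.
  have h2 := expR_ge1Dx x; have h3 := expR_le_quadratic x0 x2.
  have h5 : Z (u + d) * (expR x - 1) <= (c + e) * (expR x - 1).
    by apply: ler_wpM2r => //; lra.
  have h6 : (c + e) * (expR x - 1 - x) <= `|c + e| * (2 * x ^+ 2).
    apply: (@le_trans _ _ (`|c + e| * (expR x - 1 - x))).
      by apply: ler_wpM2r; [lra|exact: ler_norm].
    by apply: ler_wpM2l => //; lra.
  have -> : `|c + e| * (2 * s ^+ 2) * d ^+ 2 = `|c + e| * (2 * x ^+ 2).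
    by rewrite /x; ring.
  have -> : (c + e) * (s * (u + d)) = (c + e) * (s * u) + (c + e) * x.
    by rewrite /x; ring.
  by lra.
Qed.

Let drift := \sum_(i < m) p i * lam i.

Lemma drift_gt0 : 0 < drift.
Proof.
rewrite /drift (bigD1 (Ordinal (ltnW ifs_size_gt1))) //=.
rewrite ltr_wpDr // ?mulr_gt0 ?weight_gt0 ?log_ratio_gt0 //.
by apply: sumr_ge0 => i _; rewrite mulr_ge0 // ltW ?weight_gt0 ?log_ratio_gt0.
Qed.

(** The limit is identified by letting [t] tend to infinity in
[I t = \sum_i p i * (A t - A (t - lam i))], which is close both to [V] and to
[c * s * drift], where [c] is a late value of [Z]. *)
Lemma normalized_count_limit :
  (forall e : R, 0 < e -> exists T : R, forall t, T <= t -> forall t', t <= t' ->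
    `|Z t' - Z t| <= e) ->
  forall e : R, 0 < e -> exists T : R, forall t, T <= t ->
    `|Z t - V / (s * drift)| <= e.
Proof.
move=> HZ e e0; have s0 := dimension_gt0; have mu0 := drift_gt0.
have smu0 : 0 < s * drift by rewrite mulr_gt0.
have e20 : 0 < e / 2 by rewrite divr_gt0.
have [T1 HT1] := HZ _ e20.
pose T := Num.max T1 0; pose c := Z T.
have TT1 : T1 <= T by rewrite le_max lexx.
have T0 : 0 <= T by rewrite le_max lexx orbT.
have near_c t : T <= t -> c - e / 2 <= Z t <= c + e / 2.
  move=> Tt; have := HT1 _ TT1 _ Tt; rewrite -/c ler_norml => /andP[h1 h2].
  by apply/andP; split; lra.
have slope := cut_sum_slope T0 near_c.
pose L := \sum_(j < m) lam j.
have IE t : I t = \sum_(i < m) p i * (A t - A (t - lam i)).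
  rewrite /I; under [RHS]eq_bigr do rewrite mulrBr.
  by rewrite sumrB -mulr_suml s_def mul1r.
have I_le t : T + L <= t ->
    (c - e / 2) * (s * drift) <= I t <= (c + e / 2) * (s * drift).
  move=> Tt; rewrite IE /drift.
  have E (z : R) : z * (s * \sum_(i < m) p i * lam i) =
      \sum_(i < m) p i * (z * (s * lam i)).
    by rewrite !mulr_sumr; apply: eq_bigr => i _; ring.
  have H i : (c - e / 2) * (s * lam i) <= A t - A (t - lam i)
      <= (c + e / 2) * (s * lam i).
    have := slope (t - lam i) t; have -> : t - (t - lam i) = lam i by ring.
    have := log_ratio_upper i; have := log_ratio_gt0 i; rewrite -/L => h1 h2.
    by apply; lra.
  rewrite !E; apply/andP; split; apply: ler_sum => i _; rewrite ler_pM2l ?weight_gt0 //;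
    by have /andP[] := H i.
have [C C0 HC] := density_defect.
have V_le (d : R) : 0 < d ->
    (c - e / 2) * (s * drift) - d <= V <= (c + e / 2) * (s * drift) + d.
  move=> d0; have [T2 HT2] := expR_small C0 d0.
  pose t := Num.max (T + L) T2.
  have t1 : T + L <= t by rewrite le_max lexx.
  have t2 : T2 <= t by rewrite le_max lexx orbT.
  have := HC t; have := HT2 _ t2; have /andP[h1 h2] := I_le _ t1.
  rewrite /level ler_norml => h3 /andP[h4 h5].
  by apply/andP; split; lra.
have V1 : (c - e / 2) * (s * drift) <= V.
  by apply/ler_addgt0Pr => d /V_le/andP[h _]; lra.
have V2 : V <= (c + e / 2) * (s * drift).
  by apply/ler_addgt0Pr => d /V_le/andP[_ h]; lra.
rewrite -ler_pdivlMr // in V1; rewrite -ler_pdivrMr // in V2.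
exists T => t /near_c /andP[h1 h2].
by rewrite ler_norml; apply/andP; split; lra.
Qed.

Lemma counting_ratioE (h : R) : 0 < h -> counting_ratio s O h = (Z (ln h))%:E.
Proof.
move=> h0; rewrite /counting_ratio counting_orbit -EFinM; congr (_%:E).
rewrite /Z /normalized_count lnK ?posrE //; congr (_ * _).
by rewrite expRN /powR gt_eqF.
Qed.

Lemma signed_esum_density :
  (signed_esum (O `&` unit_ball) term1 + signed_esum O term2 + signed_esum E0 g)%E
    = V%:E.
Proof.
have s1 : usummable (O `&` unit_ball) term1.
  apply: (@eq_usummable _ _ _ (fun x => \sum_(i < m) (g (r i * x) - p i * g x))).
    by move=> x [_ xI]; rewrite -term1_defect mem_set.
  by apply: usummable_setI; apply: usummable_sum => i; exact: usummable_defect.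
have [s3 _] := usum_remainder min1_powRN_range.
by rewrite !signed_esumE // ?EFinD //; exact: usummable_term2.
Qed.

End orbit.

(** * Limits at infinity *)
Section limits_at_infinity.
Context {R : realType}.
Implicit Types (u : R -> \bar R) (z : R -> R).

Lemma limf_esup_pinfty u z (l : R) : (forall h : R, 0 < h -> u h = (z h)%:E) ->
  (forall e : R, 0 < e -> exists T : R, forall h, T <= h -> `|z h - l| <= e) ->
  limf_esup u (+oo%R : set_system R) = l%:E.
Proof.
move=> uz zl.
have nearl (e : R) : 0 < e -> exists T : R, forall h, T <= h ->
    ((l - e)%:E <= u h <= (l + e)%:E)%E.
  move=> /zl[T HT]; exists (Num.max T 1) => h; rewrite ge_max => /andP[hT h1].
  rewrite uz ?(lt_le_trans ltr01) // !lee_fin.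
  by have := HT _ hT; rewrite ler_norml => /andP[? ?]; apply/andP; split; lra.
apply/eqP; rewrite eq_le; apply/andP; split.
- apply/lee_addgt0Pr => e e0; have [T HT] := nearl e e0.
  apply: (@le_trans _ _ (ereal_sup (u @` [set h | T <= h]))).
    apply: ereal_inf_lbound; exists [set h | T <= h] => //.
    by exists T; split; [exact: num_real|move=> h /ltW].
  by apply: ge_ereal_sup => _ [h Th <-]; have /andP[] := HT h Th.
- apply: le_ereal_inf_tmp => _ [A [M [_ MA]] <-].
  apply/lee_subgt0Pr => e e0; have [T HT] := nearl e e0.
  pose h := Num.max T (M + 1).
  have /andP[h1 _] : ((l - e)%:E <= u h <= (l + e)%:E)%E.
    by apply: HT; rewrite le_max lexx.
  apply: (le_trans h1); apply: ereal_sup_ubound; exists h => //.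
  by apply: MA; rewrite lt_max ltrDl ltr01 orbT.
Qed.

Lemma limf_einf_pinfty u z (l : R) : (forall h : R, 0 < h -> u h = (z h)%:E) ->
  (forall e : R, 0 < e -> exists T : R, forall h, T <= h -> `|z h - l| <= e) ->
  limf_einf u (+oo%R : set_system R) = l%:E.
Proof.
move=> uz zl; rewrite /limf_einf.
rewrite (@limf_esup_pinfty _ (fun h => - z h) (- l)) ?EFinN ?oppeK //.
  by move=> h h0; rewrite /= uz.
by move=> e /zl[T HT]; exists T => h /HT; rewrite -opprD normrN.
Qed.

Lemma cauchy_sequence_limit (u : nat -> R) :
  (forall e : R, 0 < e -> exists n, forall k, (n <= k)%N -> `|u k - u n| <= e) ->
  exists l, forall e : R, 0 < e -> exists n, forall k, (n <= k)%N -> `|u k - l| <= e.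
Proof.
move=> Hu; have cu : cvg (u @ \oo).
  apply: cauchy_cvg; apply: cauchy_exP => e e0.
  have e20 : 0 < e / 2 by rewrite divr_gt0.
  have [n Hn] := Hu _ e20; exists (u n); exists n => // k /= nk.
  by rewrite /ball /= distrC (le_lt_trans (Hn k nk)) //; lra.
exists (lim (u @ \oo)) => e e0.
have /cvgrPdist_le /(_ e e0) [n _ Hn] := cu.
by exists n => k nk; rewrite distrC; exact: Hn.
Qed.

End limits_at_infinity.

(** If [Z (t + n * tau)] is uniformly Cauchy in [n] for large [t], then [Z] is
asymptotic to the function [psi t = lim_n Z (t + n * tau)], which has period
[tau]. *)
Lemma periodic_limit (R : realType) (Z : R -> R) (tau c M t0 : R) :
  0 < tau -> 0 < c -> (forall t, t0 <= t -> c <= Z t) ->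
  (forall t, 0 <= t -> Z t <= M) ->
  (forall e : R, 0 < e -> exists T : R, forall t, T <= t -> forall n,
    `|Z (t + n%:R * tau) - Z t| <= e) ->
  exists psi : R -> R, [/\ forall t, c <= psi t <= M,
    forall t, psi (t + tau) = psi t &
    forall e : R, 0 < e -> exists T : R, forall t, T <= t -> `|Z t - psi t| <= e].
Proof.
move=> tau0 c0 Zc ZM HZ.
have far t T : exists n, forall k, (n <= k)%N -> T <= t + k%:R * tau.
  exists (Num.truncn ((T - t) / tau)).+1 => k nk.
  suff : T - t <= k%:R * tau by lra.
  rewrite -ler_pdivrMr //; apply: (le_trans (ltW (truncnS_gt _))).
  by rewrite ler_nat.
have /choice[psi Hpsi] : forall t, exists l, forall e : R, 0 < e ->
    exists n, forall k, (n <= k)%N -> `|Z (t + k%:R * tau) - l| <= e.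
  move=> t; apply: (@cauchy_sequence_limit _ (fun k => Z (t + k%:R * tau))) => e e0.
  have [T HT] := HZ e e0; have [n Hn] := far t T.
  exists n => k nk; have := HT _ (Hn n (leqnn n)) (k - n)%N.
  rewrite natrB //.
  by have -> : t + n%:R * tau + (k%:R - n%:R) * tau = t + k%:R * tau by ring.
have psiE (t l : R) : (forall e : R, 0 < e -> exists n, forall k, (n <= k)%N ->
    `|Z (t + k%:R * tau) - l| <= e) -> l = psi t.
  move=> Hl; apply/eqP; rewrite -subr_eq0 -normr_le0; apply/ler_addgt0Pr => e e0.
  have e20 : 0 < e / 2 by rewrite divr_gt0.
  have [n1 H1] := Hl _ e20; have [n2 H2] := Hpsi t _ e20.
  have := H1 _ (leq_maxl n1 n2); have := H2 _ (leq_maxr n1 n2).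
  rewrite !ler_norml => /andP[a1 a2] /andP[a3 a4].
  by apply/andP; split; lra.
exists psi; split.
- move=> t; apply/andP; split; apply/ler_addgt0Pr => e e0;
    have [n1 H1] := Hpsi t e e0; have [n2 H2] := far t (Num.max t0 0);
    have := H2 _ (leq_maxr n1 n2); rewrite ge_max => /andP[tt0 t00];
    have := H1 _ (leq_maxl n1 n2); rewrite ler_norml => /andP[a1 a2].
  + by have := Zc _ tt0; lra.
  + by have := ZM _ t00; lra.
- move=> t; apply: psiE => e e0; have [n Hn] := Hpsi (t + tau) e e0.
  exists n.+1 => -[//|k] nk; have := Hn k nk.
  by have -> : t + tau + k%:R * tau = t + k.+1%:R * tau by rewrite -natr1; ring.
- move=> e e0; have e20 : 0 < e / 2 by rewrite divr_gt0.
  have [T HT] := HZ _ e20; exists T => t Tt; have [n Hn] := Hpsi t _ e20.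
  have := HT _ Tt n; have := Hn _ (leqnn n).
  rewrite !ler_norml => /andP[a1 a2] /andP[a3 a4].
  by apply/andP; split; lra.
Qed.

(** * Commensurable logarithms *)
Section commensurable.
Context {R : realType} {m : nat} (r : 'I_m -> R).
Context (m_gt0 : (0 < m)%N) (r_gt1 : forall i, 1 < `|r i|).

(** The ratios [ln |r i| / ln |r i0|] are put over a common denominator [D]; dividing
the numerators [K i] by their greatest common divisor makes them coprime. *)
Lemma commensurable_arithmetic_base :
  (forall i j : 'I_m, rational (ln `|r i| / ln `|r j|)) <->
  exists rho k, arithmetic_base r rho k.
Proof.
have ln0 i : 0 < ln `|r i| by exact: ln_gt0.
split=> [ratij|[rho [k [rho1 k0 _ rk]]] i j]; last first.
  have lnr l : ln `|r l| = (k l)%:R * ln rho.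
    by rewrite rk lnXn ?mulr_natl // (lt_trans ltr01).
  rewrite !lnr -mulf_div divff ?mulr1; first exact: rational_natdiv.
  by rewrite lt0r_neq0 // ln_gt0.
pose i0 := Ordinal m_gt0; pose x0 := ln `|r i0|.
have /choice[Q HQ] : forall i, exists q : rat, ratr q = ln `|r i| / x0.
  by move=> i; have [q _ qE] := ratij i i0; exists q.
have Q0 i : 0 < Q i by rewrite -(ltr0q R) HQ; exact: divr_gt0 (ln0 i) (ln0 i0).
pose den i := `|denq (Q i)|%N; pose num i := `|numq (Q i)|%N.
have den0 i : (0 < den i)%N by rewrite absz_gt0 denq_neq0.
have num0 i : (0 < num i)%N by rewrite absz_gt0 numq_eq0 gt_eqF.
have QE i : ratr (Q i) = (num i)%:R / (den i)%:R :> R.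
  rewrite /ratr /num /den !natr_absz !gtr0_norm ?denq_gt0 //.
  by rewrite numq_gt0.
pose D := (\prod_(j < m) den j)%N.
have D0 : (0 < D)%N by rewrite prodn_gt0.
pose K i := (num i * \prod_(j < m | j != i) den j)%N.
have K0 i : (0 < K i)%N by rewrite muln_gt0 num0 prodn_gt0.
have DE i : D = (den i * \prod_(j < m | j != i) den j)%N by rewrite /D (bigD1 i).
have KE i : ln `|r i| = (K i)%:R * (x0 / D%:R).
  have -> : ln `|r i| = ratr (Q i) * x0 by rewrite HQ divfK // lt0r_neq0 // ln0.
  rewrite QE /K (DE i) !natrM; field.
  by rewrite !pnatr_eq0 -!lt0n den0 prodn_gt0.
pose G := (\big[gcdn/0%N]_(i < m) K i).
have GK i : (G %| K i)%N by exact: (biggcdn_inf i).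
have G0 : (0 < G)%N by rewrite (dvdn_gt0 (K0 i0)).
pose k i := (K i %/ G)%N.
have kK i : K i = (G * k i)%N by rewrite mulnC divnK.
exists (expR (G%:R * (x0 / D%:R))), k; split.
- rewrite -[ltLHS]expR0 ltr_expR; apply: mulr_gt0; first by rewrite ltr0n.
  by apply: divr_gt0; [exact: ln0|rewrite ltr0n].
- by move=> i; rewrite divn_gt0 // dvdn_leq.
- apply/eqP; rewrite -(eqn_pmul2l G0) muln1; apply/eqP.
  rewrite (big_morph (muln G) (muln_gcdr G) (muln0 G)).
  by apply: eq_bigr => i _; rewrite kK.
- move=> i; rewrite -expRM_natl -[LHS]lnK ?posrE ?(lt_trans ltr01) //.
  by rewrite KE kK natrM; congr expR; ring.
Qed.

End commensurable.

Theorem theorem5p1 (R : realType) (m : nat) (r b : 'I_m -> R) (a s : R)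
  (f := affine_map r b) (O := forward_orbit f a)
  (f_distinct : injective f)
  (r_gt1 : forall i, 1 < `|r i|)
  (f_nondegenerate : ~ degenerate f)
  (s_def : \sum_(i < m) `|r i| `^ (- s) = 1)
  (O_non_overlapping : non_overlapping f O)
  (O_ulf : uniformly_locally_finite O) :
  ((exists i j : 'I_m, i != j /\ irrational (ln `|r i| / ln `|r j|)) ->
    let I_open : set R := (`]-1, 1[)%classic in
    let normalization : R :=
      (s * (\sum_(i < m) `|r i| `^ (- s) * ln `|r i|))^-1 in
    let term1 (x : R) : R := (\sum_(i < m) min1_powRN s (r i * x)) - 1 in
    let term2 (x : R) : R :=
      \sum_(i < m) (min1_powRN s (r i * x + b i) - min1_powRN s (r i * x)) in
    let term3 (x : R) : R := min1_powRN s x in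
    [/\ summable O (EFin \o term2),
        lower_central_density s O = upper_central_density s O &
        upper_central_density s O =
          (normalization%:E *
             (signed_esum (O `&` I_open) term1
              + signed_esum O term2
              + signed_esum (O `\` \bigcup_(i : 'I_m) (f i @` O)) term3))%E])
  /\
  (let all_rational :=
    forall i j : 'I_m, rational (ln `|r i| / ln `|r j|) in
  (all_rational <-> exists rho k, arithmetic_base r rho k) /\
  (all_rational -> forall rho k, arithmetic_base r rho k ->
    exists (C' : R) (phi : R -> R),
      [/\ 1 < C',
          forall h, 1 <= h -> 0 < phi h,
          forall h, 1 <= h -> C'^-1 <= phi h <= C',
          forall h, 1 <= h -> phi (rho * h) = phi h &
          (`|counting_ratio s O h - (phi h)%:E|)%E @[h --> +oo] --> 0%E])).
Proof.
pose Z := normalized_count r b a s.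
have ratioE (h : R) : 0 < h -> counting_ratio s O h = (Z (ln h))%:E.
  exact: counting_ratioE.
have ln_far (T h : R) : expR T <= h -> T <= ln h.
  move=> Th; rewrite -[T]expRK ler_ln ?posrE ?expR_gt0 //.
  exact: lt_le_trans (expR_gt0 T) Th.
split.
  move=> [i [j [_ irr]]] I_open normalization term1 term2 term3.
  have HZ := normalized_count_cauchy r_gt1 f_nondegenerate s_def
    O_non_overlapping O_ulf irr.
  have := normalized_count_limit r_gt1 f_nondegenerate s_def
    O_non_overlapping O_ulf HZ.
  have := signed_esum_density r_gt1 f_nondegenerate s_def O_ulf.
  set V := (usum _ _ + usum _ _ + usum _ _)%R => VE lim.
  have zl (e : R) : 0 < e -> exists T : R, forall h, T <= h ->
      `|Z (ln h) - normalization * V| <= e.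
    move=> /lim[T HT]; exists (expR T) => h /ln_far /HT.
    by rewrite [V / _]mulrC.
  have usup : upper_central_density s O = (normalization * V)%:E.
    exact: limf_esup_pinfty ratioE zl.
  split.
  - exact: usummable_term2.
  - by rewrite usup; exact: limf_einf_pinfty ratioE zl.
  - by rewrite usup EFinM -VE.
split.
  apply: commensurable_arithmetic_base => //.
  exact: ltnW (ifs_size_gt1 r_gt1 f_nondegenerate).
move=> _ rho k base; have [rho1 _ _ _] := base.
have [c c0 [t0 Zc]] := normalized_count_lower r_gt1 f_nondegenerate s_def
  O_non_overlapping O_ulf.
have [M ZM] := normalized_count_upper r_gt1 f_nondegenerate s_def
  O_non_overlapping O_ulf.
have [psi [psi_le psi_per psi_lim]] := periodic_limit (ln_gt0 rho1) c0 Zc ZM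
  (normalized_count_cauchy_coset r_gt1 f_nondegenerate s_def
    O_non_overlapping O_ulf base).
have /andP[cM1 cM2] := psi_le 0.
have M0 : 0 < M by lra.
have ci0 : 0 < c^-1 by rewrite invr_gt0.
pose C' := c^-1 + M + 1.
have C'c : C'^-1 <= c.
  by rewrite -[leRHS]invrK lef_pV2 ?posrE /C' //; lra.
exists C', (fun h => psi (ln h)); split.
- by rewrite /C'; lra.
- by move=> h _; have /andP[] := psi_le (ln h); lra.
- move=> h _; have /andP[h1 h2] := psi_le (ln h); rewrite /C' in C'c *.
  by apply/andP; split; lra.
- move=> h h1.
  by rewrite lnM ?posrE ?(lt_le_trans ltr01 h1) ?(lt_trans ltr01 rho1) // addrC psi_per.
have real_cvg : `|Z (ln h) - psi (ln h)| @[h --> +oo] --> (0 : R).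
  apply/cvgrPdist_le => e /psi_lim[T HT].
  exists (expR T); split; first exact: num_real.
  by move=> y /ltW /ln_far /HT; rewrite sub0r normrN normr_id.
have ereal_cvg : (`|Z (ln h) - psi (ln h)|)%:E @[h --> +oo] --> 0%:E.
  by apply: cvg_EFin real_cvg; exists 0; split; first exact: num_real.
apply: cvg_trans ereal_cvg; apply: near_eq_cvg.
exists 0; split; first exact: num_real.
by move=> y y0; rewrite ratioE.
Qed.
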